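(* (ZF, without the Axiom of Choice.) For each infinite cardinal $\kappa\in On$ the following statements are equivalent: (i) $cf(\kappa^+)=\kappa^+$; (ii) $|\mathbb T_{<\kappa^+}|\le\kappa$; (iii) $Regressive(\kappa^+,\kappa^+)$; (iv) ${[\kappa^+]}^{<\omega}\to\Delta(\kappa^+)$. Moreover, $cf(\kappa^+)=\kappa^+$ implies (v) $\kappa^+\to(\kappa^+,\omega+1)$, and (v) implies (vi) $cf(\kappa^+)>\omega$.
   Context: The base theory is ZF. Cardinals are initial ordinals; $\kappa^+$ is the least cardinal in $On$ greater than $\kappa$. For infinite cardinals $\kappa,\lambda\in On$, the notation $|\mathbb T_{<\kappa}|\le\lambda$ means: for each tree $T\subset On^{<\omega}$ (a set of finite sequences of ordinals closed under initial segments), if $|\{\alpha\in On: s^\frown\alpha\in T\}|<\kappa$ for every $s\in T$, then $|T|\le\lambda$. For cardinals $\mu,\lambda\in On$, $Regressive(\mu,\lambda)$ means: for each regressive function $f:\mu\to\mu$ (i.e. $f(\alpha)<\alpha$ for all $0<\alpha<\mu$) there is $\alpha<\mu$ such that $|f^{-1}\{\alpha\}|\ge\lambda$. For infinite cardinals $\mu,\lambda$, ${[\mu]}^{<\omega}\to\Delta(\lambda)$ means: every family $\mathcal A$ of finite sets of ordinals with $|\mathcal A|=\mu$ contains a $\Delta$-system $\mathcal B\subset\mathcal A$ with $|\mathcal B|=\lambda$ (a $\Delta$-system is a family for which there is a set $D$, the kernel, such that $A\cap B=D$ for all distinct members $A,B$). $\mu\to(\lambda,\omega+1)$ means: for every $f:[\mu]^2\to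 2$ there is either a set $H\subset\mu$ of order type $\lambda$ with $f$ constantly $0$ on $[H]^2$, or a set $H\subset\mu$ of order type $\omega+1$ with $f$ constantly $1$ on $[H]^2$. *)

(* Defs.v *)
(** Models of first-order ZF, and the notions of set theory interpreted inside
    such a model.

    "ZF proves P" is rendered as "P holds in every model of first-order ZF".
    Separation and Replacement range only over relations defined by formulas of
    the language {∈, =} with parameters.  Letting them range over arbitrary
    predicates of type [M -> Prop] would give second-order ZF, whose models
    satisfy the Axiom of Choice as soon as the metatheory does.

    Everything below is relative to the model: every quantifier ranges over its
    elements, and "function", "natural number", "finite", ... are the internal
    notions.  An operation of set theory (pair, successor, cofinality, ...) is
    given by its graph. *)

Record set_structure := {
  carrier :> Type;
  mem : carrier -> carrier -> Prop }.

Arguments mem {s} x y.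

Declare Scope set_scope.
Open Scope set_scope.
Notation "x ∈ y" := (mem x y) (at level 70, no associativity) : set_scope.
Notation "x ∉ y" := (~ mem x y) (at level 70, no associativity) : set_scope.

(** * First-order formulas (de Bruijn indices) *)

Inductive formula : Type :=
| FMem (i j : nat)
| FEq (i j : nat)
| FNot (p : formula)
| FAnd (p q : formula)
| FOr (p q : formula)
| FImp (p q : formula)
| FAll (p : formula)
| FEx (p : formula).

Definition scons {T : Type} (x : T) (rho : nat -> T) (n : nat) : T :=
  match n with O => x | S k => rho k end.

Fixpoint sat {M : set_structure} (rho : nat -> M) (p : formula) : Prop :=
  match p with
  | FMem i j => rho i ∈ rho j
  | FEq i j => rho i = rho j
  | FNot p => ~ sat rho p
  | FAnd p q => sat rho p /\ sat rho q
  | FOr p q => sat rho p \/ sat rho q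
  | FImp p q => sat rho p -> sat rho q
  | FAll p => forall x : M, sat (scons x rho) p
  | FEx p => exists x : M, sat (scons x rho) p
  end.

(** * Basic set-theoretic notions *)

Definition subset {M : set_structure} (x y : M) : Prop :=
  forall z : M, z ∈ x -> z ∈ y.
Notation "x ⊆ y" := (subset x y) (at level 70, no associativity) : set_scope.

Definition empty {M : set_structure} (x : M) : Prop :=
  forall z : M, z ∉ x.

(** [x = {a, b}] *)
Definition upair {M : set_structure} (a b x : M) : Prop :=
  forall z : M, z ∈ x <-> z = a \/ z = b.

(** [p = (a, b) = {{a}, {a, b}}] *)
Definition opair {M : set_structure} (a b p : M) : Prop :=
  exists s t : M, upair a a s /\ upair a b t /\ upair s t p.

(** [y = x ∪ {x}] *)
Definition succ {M : set_structure} (x y : M) : Prop :=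
  forall z : M, z ∈ y <-> z ∈ x \/ z = x.

(** * The axioms *)

Record ZF (M : set_structure) : Prop := {
  ZF_extensionality : forall x y : M, (forall z : M, z ∈ x <-> z ∈ y) -> x = y;
  ZF_foundation : forall x : M, (exists y : M, y ∈ x) ->
    exists y : M, y ∈ x /\ forall z : M, z ∈ x -> z ∉ y;
  ZF_pairing : forall a b : M, exists x : M, upair a b x;
  ZF_union : forall x : M, exists u : M,
    forall z : M, z ∈ u <-> exists y : M, y ∈ x /\ z ∈ y;
  ZF_powerset : forall x : M, exists p : M, forall z : M, z ∈ p <-> z ⊆ x;
  ZF_infinity : exists w : M,
    (exists e : M, empty e /\ e ∈ w) /\
    (forall x : M, x ∈ w -> exists y : M, succ x y /\ y ∈ w);
  ZF_separation : forall (p : formula) (rho : nat -> M) (a : M), exists b : M,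
    forall x : M, x ∈ b <-> x ∈ a /\ sat (scons x rho) p;
  ZF_replacement : forall (p : formula) (rho : nat -> M) (a : M),
    (forall x y y' : M, x ∈ a ->
       sat (scons x (scons y rho)) p -> sat (scons x (scons y' rho)) p ->
       y = y') ->
    exists b : M, forall y : M,
      y ∈ b <-> exists x : M, x ∈ a /\ sat (scons x (scons y rho)) p }.

(** * Functions and cardinality *)

(** [f(x) = y] *)
Definition app {M : set_structure} (f x y : M) : Prop :=
  exists p : M, opair x y p /\ p ∈ f.

Definition is_fun {M : set_structure} (f a b : M) : Prop :=
  (forall p : M, p ∈ f ->
     exists x y : M, x ∈ a /\ y ∈ b /\ opair x y p) /\
  (forall x : M, x ∈ a -> exists! y : M, app f x y).

Definition is_injection {M : set_structure} (f a b : M) : Prop :=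
  is_fun f a b /\
  forall x x' y : M, app f x y -> app f x' y -> x = x'.

Definition is_bijection {M : set_structure} (f a b : M) : Prop :=
  is_injection f a b /\
  forall y : M, y ∈ b -> exists x : M, app f x y.

Definition equipotent {M : set_structure} (a b : M) : Prop :=
  exists f : M, is_bijection f a b.

Definition card_le {M : set_structure} (a b : M) : Prop :=
  exists f : M, is_injection f a b.

Definition card_lt {M : set_structure} (a b : M) : Prop :=
  card_le a b /\ ~ equipotent a b.

(** * Ordinals and cardinals *)

Definition transitive {M : set_structure} (a : M) : Prop :=
  forall x : M, x ∈ a -> x ⊆ a.

(** By Foundation, ∈ well-orders every transitive set of transitive sets.
    Between ordinals, [<] is [∈] and [<=] is [⊆]. *)
Definition ordinal {M : set_structure} (a : M) : Prop :=
  transitive a /\ forall x : M, x ∈ a -> transitive x.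

Definition natural {M : set_structure} (n : M) : Prop :=
  ordinal n /\
  forall m : M, m ∈ n \/ m = n -> empty m \/ exists k : M, succ k m.

Definition is_omega {M : set_structure} (w : M) : Prop :=
  forall n : M, n ∈ w <-> natural n.

Definition finite {M : set_structure} (x : M) : Prop :=
  exists n : M, natural n /\ equipotent n x.

Definition cardinal {M : set_structure} (k : M) : Prop :=
  ordinal k /\ forall a : M, a ∈ k -> ~ equipotent a k.

Definition infinite_cardinal {M : set_structure} (k : M) : Prop :=
  cardinal k /\ ~ finite k.

(** [kplus = k⁺] *)
Definition successor_cardinal {M : set_structure} (k kplus : M) : Prop :=
  cardinal kplus /\ k ∈ kplus /\
  forall l : M, cardinal l -> k ∈ l -> kplus ⊆ l.

(** * Cofinality *)

Definition has_cofinal_map {M : set_structure} (c a : M) : Prop :=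
  exists f : M, is_fun f c a /\
    forall x : M, x ∈ a -> exists i y : M, app f i y /\ x ⊆ y.

(** [cf(a) = c], for a limit ordinal [a] *)
Definition is_cf {M : set_structure} (a c : M) : Prop :=
  ordinal c /\ has_cofinal_map c a /\
  forall d : M, ordinal d -> has_cofinal_map d a -> c ⊆ d.

Definition uncountable_cf {M : set_structure} (a : M) : Prop :=
  exists w c : M, is_omega w /\ is_cf a c /\ w ∈ c.

(** * Trees of finite sequences of ordinals *)

Definition ord_seq {M : set_structure} (s n : M) : Prop :=
  natural n /\
  exists b : M, (forall a : M, a ∈ b -> ordinal a) /\ is_fun s n b.

Definition fin_ord_seq {M : set_structure} (s : M) : Prop :=
  exists n : M, ord_seq s n.

(** [t = s⌢a = s ∪ {(n, a)}], where [n] is the length of [s] *)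
Definition snoc {M : set_structure} (s a t : M) : Prop :=
  exists n p : M, ord_seq s n /\ opair n a p /\
    forall z : M, z ∈ t <-> z ∈ s \/ z = p.

(** For functions whose domains are natural numbers, inclusion of graphs is
    being an initial segment. *)
Definition tree {M : set_structure} (T : M) : Prop :=
  (forall s : M, s ∈ T -> fin_ord_seq s) /\
  (forall s t : M, s ∈ T -> fin_ord_seq t -> t ⊆ s -> t ∈ T).

Definition tree_bound {M : set_structure} (kappa lambda : M) : Prop :=
  forall T : M, tree T ->
    (forall s : M, s ∈ T ->
       exists c : M,
         (forall a : M,
            a ∈ c <-> ordinal a /\ exists t : M, snoc s a t /\ t ∈ T) /\
         card_lt c kappa) ->
    card_le T lambda.

(** * Regressive functions *)

Definition regressive_fun {M : set_structure} (f mu : M) : Prop :=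
  is_fun f mu mu /\
  forall a y : M, a ∈ mu -> ~ empty a -> app f a y -> y ∈ a.

Definition Regressive {M : set_structure} (mu lambda : M) : Prop :=
  forall f : M, regressive_fun f mu ->
    exists a : M, a ∈ mu /\
      exists fibre : M,
        (forall x : M, x ∈ fibre <-> app f x a) /\ card_le lambda fibre.

(** * Δ-systems *)

Definition delta_system {M : set_structure} (B : M) : Prop :=
  exists D : M, forall X Y : M, X ∈ B -> Y ∈ B -> X <> Y ->
    forall z : M, z ∈ D <-> z ∈ X /\ z ∈ Y.

Definition delta_arrow {M : set_structure} (mu lambda : M) : Prop :=
  forall A : M,
    (forall X : M, X ∈ A ->
       finite X /\ forall a : M, a ∈ X -> ordinal a) ->
    equipotent A mu ->
    exists B : M, B ⊆ A /\ delta_system B /\ equipotent B lambda.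

(** * Partition relations *)

(** [P = [mu]²] *)
Definition unordered_pairs {M : set_structure} (mu P : M) : Prop :=
  forall x : M, x ∈ P <->
    exists a b : M, a ∈ mu /\ b ∈ mu /\ a <> b /\ upair a b x.

(** [f] is constantly [i] on [[H]²] *)
Definition constant_on_pairs {M : set_structure} (f H i : M) : Prop :=
  forall a b x : M, a ∈ H -> b ∈ H -> a <> b -> upair a b x -> app f x i.

(** The set [H] of ordinals has order type [a]. *)
Definition order_type {M : set_structure} (H a : M) : Prop :=
  ordinal a /\
  exists f : M, is_bijection f a H /\
    forall x y u v : M, app f x u -> app f y v -> (x ∈ y <-> u ∈ v).

(** [mu → (alpha, beta)] *)
Definition partition_arrow {M : set_structure} (mu alpha beta : M) : Prop :=
  forall zero one two P f : M,
    empty zero -> succ zero one -> succ one two -> unordered_pairs mu P ->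
    is_fun f P two ->
    (exists H : M, H ⊆ mu /\ order_type H alpha /\ constant_on_pairs f H zero) \/
    (exists H : M, H ⊆ mu /\ order_type H beta /\ constant_on_pairs f H one).

(** [mu → (lambda, ω + 1)] *)
Definition partition_arrow_omega_plus_one {M : set_structure} (mu lambda : M) :
  Prop :=
  exists w w1 : M, is_omega w /\ succ w w1 /\ partition_arrow mu lambda w1.

(* Main.v *)
From Stdlib Require Import Classical ClassicalEpsilon Arith.
Require Import Defs.

(** Separation and Replacement only apply to formulas, so every class and every
    operation used below is shown to be definable with parameters ([Dfn] for
    relations, [DTrm] for operations).

    Write [mu] for the successor cardinal.  If [mu] is regular, every function
    from [mu] to a set of size at most [kappa] has an unbounded fibre.
    - (ii): finite sequences of ordinals are well-ordered by length and first
      difference, so if a tree or one of its levels is not of size at most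
      [kappa], then [mu] injects into it.  By the fibre property a copy of [mu]
      in the tree gives one in some level, and a copy in level [n + 1] gives one
      in level [n] or in the set of immediate successors of a single node.
    - Pressing down: if [X a] is a finite subset of [a] for all [a] in [mu],
      then [X] has an unbounded fibre, since by (ii) there are at most [kappa]
      finite subsets of each [b] in [mu].  Singletons give (iii).  For (v), let
      [X a] be the greedily chosen subset of [a] that is homogeneous of colour 1
      together with [a]: either some choice lasts for [omega] steps, or all [X a]
      are finite and an unbounded fibre is homogeneous of colour 0.
    - (iv): among the sets of a fixed size [n] occurring unboundedly often, take
      a kernel [D] of maximal size contained in unboundedly many of them, and
      select recursively sets that meet the earlier ones only in [D].

    Conversely, a cofinal map [F : d -> mu] with [d < mu] gives the index
    [I a], the least [i] with [a <= F i].  It is regressive above [d] with bounded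
    fibres; the sequences (I a, a) form a tree, and the pairs {I a, d + a} a
    family without large Delta-systems.  When [d = omega], colouring pairs by
    whether their indices differ refutes (v). *)

Existing Class ZF.

(** * Definability with parameters *)

Section Formulas.
Context {M : set_structure}.

Lemma sat_ext (p : formula) : forall rho rho' : nat -> M,
  (forall i, rho i = rho' i) -> sat rho p <-> sat rho' p.
Proof.
  induction p as [i j|i j|p IH|p IHp q IHq|p IHp q IHq|p IHp q IHq|p IH|p IH];
    intros rho rho' H; simpl.
  - now rewrite !H.
  - now rewrite !H.
  - now rewrite (IH _ _ H).
  - now rewrite (IHp _ _ H), (IHq _ _ H).
  - now rewrite (IHp _ _ H), (IHq _ _ H).
  - now rewrite (IHp _ _ H), (IHq _ _ H).
  - split; intros H' x; apply (IH (scons x rho) (scons x rho')); auto;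
      intros [|i]; simpl; auto.
  - split; intros [x H']; exists x; apply (IH (scons x rho) (scons x rho')); auto;
      intros [|i]; simpl; auto.
Qed.

Fixpoint ren (r : nat -> nat) (p : formula) : formula :=
  match p with
  | FMem i j => FMem (r i) (r j)
  | FEq i j => FEq (r i) (r j)
  | FNot p => FNot (ren r p)
  | FAnd p q => FAnd (ren r p) (ren r q)
  | FOr p q => FOr (ren r p) (ren r q)
  | FImp p q => FImp (ren r p) (ren r q)
  | FAll p => FAll (ren (scons 0 (fun i => S (r i))) p)
  | FEx p => FEx (ren (scons 0 (fun i => S (r i))) p)
  end.

Lemma sat_ren (p : formula) : forall (r : nat -> nat) (rho : nat -> M),
  sat rho (ren r p) <-> sat (fun i => rho (r i)) p.
Proof.
  induction p as [i j|i j|p IH|p IHp q IHq|p IHp q IHq|p IHp q IHq|p IH|p IH];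
    intros r rho; simpl; try tauto.
  - now rewrite IH.
  - now rewrite IHp, IHq.
  - now rewrite IHp, IHq.
  - now rewrite IHp, IHq.
  - split; intros H x; specialize (H x).
    + apply IH in H; revert H; apply sat_ext; intros [|i]; reflexivity.
    + apply IH; revert H; apply sat_ext; intros [|i]; reflexivity.
  - split; intros [x H]; exists x.
    + apply IH in H; revert H; apply sat_ext; intros [|i]; reflexivity.
    + apply IH; revert H; apply sat_ext; intros [|i]; reflexivity.
Qed.

(** A slot of a formula is filled by a variable of the environment or by a
    parameter. *)
Definition fill (e : nat -> M) (v : nat + M) : M :=
  match v with inl i => e i | inr c => c end.

(** Predicates are taken on whole environments so that the closure rules below can follow the shape
    of a statement and leave its parameters implicit. *)
Definition Dfn (P : (nat -> M) -> Prop) : Prop :=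
  exists (p : formula) (v : nat -> nat + M),
    forall e, P e <-> sat (fun i => fill e (v i)) p.

(** [t] is definable when the relation [y = t(e)] is; the new variable [y] is
    [e 0]. *)
Definition DTrm (t : (nat -> M) -> M) : Prop :=
  Dfn (fun e => e 0 = t (fun i => e (S i))).

Lemma Dfn_iff (P Q : (nat -> M) -> Prop) :
  (forall e, P e <-> Q e) -> Dfn Q -> Dfn P.
Proof.
  intros H (p & v & Hp); exists p, v; intros e; rewrite H; apply Hp.
Qed.

Lemma Dfn_ren (P : (nat -> M) -> Prop) (r : nat -> nat) :
  Dfn P -> Dfn (fun e => P (fun i => e (r i))).
Proof.
  intros (p & v & Hp).
  exists p, (fun i => match v i with inl k => inl (r k) | inr c => inr c end).
  intros e; rewrite Hp; apply sat_ext; intros i; now destruct (v i).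
Qed.

(** Interleaves two slot assignments on even and odd indices, so that two formulas, each with its
    own parameters, can be read in one environment. *)
Definition join (v w : nat -> nat + M) (n : nat) : nat + M :=
  if Nat.even n then v (Nat.div2 n) else w (Nat.div2 n).

Lemma Dfn_binary (c : formula -> formula -> formula) (C : Prop -> Prop -> Prop)
  (HC : forall (rho : nat -> M) p q, sat rho (c p q) <-> C (sat rho p) (sat rho q))
  (HC' : forall A A' B B', (A <-> A') -> (B <-> B') -> (C A B <-> C A' B'))
  (P Q : (nat -> M) -> Prop) :
  Dfn P -> Dfn Q -> Dfn (fun e => C (P e) (Q e)).
Proof.
  intros (p & v & Hp) (q & w & Hq).
  exists (c (ren (fun i => 2 * i) p) (ren (fun i => 2 * i + 1) q)), (join v w).
  intros e; rewrite HC; apply HC'; rewrite sat_ren.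
  - rewrite Hp; apply sat_ext; intros i; unfold join.
    now rewrite Nat.even_even, Nat.div2_double.
  - rewrite Hq; apply sat_ext; intros i; unfold join.
    rewrite Nat.even_odd, Nat.add_1_r, Nat.div2_succ_double; reflexivity.
Qed.

Lemma Dfn_and (P Q : (nat -> M) -> Prop) :
  Dfn P -> Dfn Q -> Dfn (fun e => P e /\ Q e).
Proof. apply (Dfn_binary FAnd and); simpl; tauto. Qed.

Lemma Dfn_or (P Q : (nat -> M) -> Prop) :
  Dfn P -> Dfn Q -> Dfn (fun e => P e \/ Q e).
Proof. apply (Dfn_binary FOr or); simpl; tauto. Qed.

Lemma Dfn_imp (P Q : (nat -> M) -> Prop) :
  Dfn P -> Dfn Q -> Dfn (fun e => P e -> Q e).
Proof. apply (Dfn_binary FImp (fun A B => A -> B)); simpl; tauto. Qed.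

Lemma Dfn_not (P : (nat -> M) -> Prop) : Dfn P -> Dfn (fun e => ~ P e).
Proof.
  intros (p & v & Hp); exists (FNot p), v; intros e; simpl; now rewrite Hp.
Qed.

Lemma Dfn_equiv (P Q : (nat -> M) -> Prop) :
  Dfn P -> Dfn Q -> Dfn (fun e => P e <-> Q e).
Proof. intros HP HQ; apply Dfn_and; apply Dfn_imp; assumption. Qed.

Lemma Dfn_const (P : Prop) : Dfn (fun _ => P).
Proof.
  destruct (classic P) as [H|H].
  - exists (FEq 0 0), inl; simpl; tauto.
  - exists (FNot (FEq 0 0)), inl; simpl; tauto.
Qed.

(** Used to pass under a quantifier: slots that hold variable 0 are redirected to the bound
    variable, and all others move up by one. *)
Lemma bind_slot (v : nat -> nat + M) :
  exists (r : nat -> nat) (v' : nat -> nat + M), forall e x i,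
    fill (scons x e) (v i) = scons x (fun j => fill e (v' j)) (r i).
Proof.
  exists (fun i => match v i with inl 0 => 0 | _ => S i end),
    (fun i => match v i with inl (S k) => inl k | w => w end).
  intros e x i.
  destruct (v i) as [[|k]|c] eqn:E; simpl; rewrite ?E; reflexivity.
Qed.

Lemma Dfn_ex (Q : M -> (nat -> M) -> Prop) :
  Dfn (fun e => Q (e 0) (fun i => e (S i))) -> Dfn (fun e => exists x, Q x e).
Proof.
  intros (p & v & Hp); destruct (bind_slot v) as (r & v' & H).
  exists (FEx (ren r p)), v'; intros e; simpl.
  split; intros [x Hx]; exists x.
  - apply sat_ren; apply (Hp (scons x e)) in Hx.
    revert Hx; apply sat_ext; intros i; symmetry; apply H.
  - apply (proj1 (sat_ren _ _ _)) in Hx; apply (Hp (scons x e)).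
    revert Hx; apply sat_ext; intros i; apply H.
Qed.

Lemma Dfn_all (Q : M -> (nat -> M) -> Prop) :
  Dfn (fun e => Q (e 0) (fun i => e (S i))) -> Dfn (fun e => forall x, Q x e).
Proof.
  intros H.
  apply (Dfn_iff _ (fun e => ~ exists x, ~ Q x e)).
  - intros e; split.
    + intros H1 [x Hx]; auto.
    + intros H1 x; apply NNPP; intros Hx; apply H1; eauto.
  - apply Dfn_not, (Dfn_ex (fun x e => ~ Q x e)), Dfn_not, H.
Qed.

Lemma Dfn_inst (P : M -> (nat -> M) -> Prop) (k : nat) (r : nat -> nat) :
  Dfn (fun e => P (e 0) (fun i => e (S i))) ->
  Dfn (fun e => P (e k) (fun i => e (r i))).
Proof. intros H; exact (Dfn_ren _ (scons k r) H). Qed.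

Lemma DTrm_ren (t : (nat -> M) -> M) (r : nat -> nat) :
  DTrm t -> DTrm (fun e => t (fun i => e (r i))).
Proof.
  intros H; exact (Dfn_ren _ (fun i => match i with 0 => 0 | S j => S (r j) end) H).
Qed.

Lemma DTrm_var (k : nat) : DTrm (fun e => e k).
Proof.
  exists (FEq 0 1), (fun i => match i with 0 => inl 0 | _ => inl (S k) end).
  intros e; simpl; tauto.
Qed.

Lemma DTrm_const (c : M) : DTrm (fun _ => c).
Proof.
  exists (FEq 0 1), (fun i => match i with 0 => inl 0 | _ => inr c end).
  intros e; simpl; tauto.
Qed.

(** Substituting a term is expressed by quantifying over its value, so operations known only through
    their graphs can be used as terms. *)
Lemma Dfn_app (P : M -> (nat -> M) -> Prop) (t : (nat -> M) -> M) :
  Dfn (fun e => P (e 0) (fun i => e (S i))) -> DTrm t -> Dfn (fun e => P (t e) e).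
Proof.
  intros HP Ht; apply (Dfn_iff _ (fun e => exists x, x = t e /\ P x e)).
  - intros e; split; [eauto|now intros [x [-> Hx]]].
  - apply (Dfn_ex (fun x e => x = t e /\ P x e)), Dfn_and; assumption.
Qed.

Lemma Dfn_app1 (P : M -> Prop) (t : (nat -> M) -> M) :
  Dfn (fun e => P (e 0)) -> DTrm t -> Dfn (fun e => P (t e)).
Proof. exact (Dfn_app (fun x _ => P x) t). Qed.

Lemma Dfn_app2 (P : M -> M -> Prop) (t s : (nat -> M) -> M) :
  Dfn (fun e => P (e 0) (e 1)) -> DTrm t -> DTrm s -> Dfn (fun e => P (t e) (s e)).
Proof.
  intros HP Ht Hs; apply (Dfn_app (fun x e => P x (s e)) t); [|assumption].
  apply (Dfn_app (fun y e => P (e 0) y) (fun e => s (fun i => e (S i)))).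
  - exact (Dfn_ren _ (fun i => match i with 0 => 1 | 1 => 0 | _ => i end) HP).
  - now apply DTrm_ren.
Qed.

Lemma Dfn_mem (t s : (nat -> M) -> M) :
  DTrm t -> DTrm s -> Dfn (fun e => t e ∈ s e).
Proof.
  apply (Dfn_app2 mem); exists (FMem 0 1), inl; simpl; tauto.
Qed.

Lemma Dfn_eq (t s : (nat -> M) -> M) :
  DTrm t -> DTrm s -> Dfn (fun e => t e = s e).
Proof.
  apply (Dfn_app2 eq); exists (FEq 0 1), inl; simpl; tauto.
Qed.

Lemma DTrm_app (F : M -> (nat -> M) -> M) (t : (nat -> M) -> M) :
  DTrm (fun e => F (e 0) (fun i => e (S i))) -> DTrm t -> DTrm (fun e => F (t e) e).
Proof.
  intros HF Ht.
  apply (Dfn_app (fun x e => e 0 = F x (fun i => e (S i))) (fun e => t (fun i => e (S i)))).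
  - exact (Dfn_ren _ (fun i => match i with 0 => 1 | 1 => 0 | _ => i end) HF).
  - now apply (DTrm_ren t S).
Qed.

Lemma DTrm_app1 (F : M -> M) (t : (nat -> M) -> M) :
  DTrm (fun e => F (e 0)) -> DTrm t -> DTrm (fun e => F (t e)).
Proof. exact (DTrm_app (fun x _ => F x) t). Qed.

Lemma DTrm_app2 (F : M -> M -> M) (t s : (nat -> M) -> M) :
  DTrm (fun e => F (e 0) (e 1)) -> DTrm t -> DTrm s -> DTrm (fun e => F (t e) (s e)).
Proof.
  intros HF Ht Hs; apply (DTrm_app (fun x e => F x (s e)) t); [|assumption].
  apply (DTrm_app (fun y e => F (e 0) y) (fun e => s (fun i => e (S i)))).
  - exact (DTrm_ren _ (fun i => match i with 0 => 1 | 1 => 0 | _ => i end) HF).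
  - now apply DTrm_ren.
Qed.

(** Brings a definable relation into the form that Separation and Replacement accept: arguments in
    variables 0 and 1, parameters after them. The element [d] stands in for the remaining variables,
    on which the relation does not depend. *)
Lemma Dfn_relation (R : M -> M -> Prop) :
  Dfn (fun e => R (e 0) (e 1)) ->
  forall d : M, exists p rho, forall x y, R x y <-> sat (scons x (scons y rho)) p.
Proof.
  intros (p & v & Hp) d.
  exists (ren (fun i => match v i with inl 0 => 0 | inl 1 => 1 | _ => S (S i) end) p),
    (fun i => match v i with inl _ => d | inr c => c end).
  intros x y; rewrite (Hp (scons x (scons y (fun _ => d)))), sat_ren.
  apply sat_ext; intros i.
  destruct (v i) as [[|[|k]]|c] eqn:E; simpl; rewrite ?E; reflexivity.
Qed.

End Formulas.

(* Closure rules for later notions are plugged in here by redefinition. *)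
Ltac dfn_set := fail.

(** Definability is proved by recursion on the syntax of the goal. Abstract predicates and
    operations are handled by matching a definability hypothesis of the context against the goal up
    to its arguments. *)
Ltac dfn_step :=
  cbv beta;
  lazymatch goal with
  | |- Dfn (fun e => _ /\ _) => apply Dfn_and
  | |- Dfn (fun e => _ \/ _) => apply Dfn_or
  | |- Dfn (fun e => ~ _) => apply Dfn_not
  | |- Dfn (fun e => _ <-> _) => apply Dfn_equiv
  | |- Dfn (fun e => exists x, _) => apply Dfn_ex
  | |- Dfn (fun e => _ ∈ _) => apply Dfn_mem
  | |- Dfn (fun e => _ = _) => apply Dfn_eq
  | |- _ => first
     [ assumption
     | apply Dfn_const
     | apply DTrm_const
     | apply DTrm_var
     | match goal with
       | |- Dfn (fun e => _ -> _) => apply Dfn_imp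
       | |- Dfn (fun e => forall x, _) => apply Dfn_all
       | H : Dfn (fun e => ?P (e 0)) |- Dfn (fun e => ?P (@?t e)) =>
           apply (Dfn_app1 P t H)
       | H : Dfn (fun e => ?P (e 0) (e 1)) |- Dfn (fun e => ?P (@?t e) (@?s e)) =>
           apply (Dfn_app2 P t s H)
       | H : DTrm (fun e => ?P (e 0)) |- DTrm (fun e => ?P (@?t e)) =>
           apply (DTrm_app1 P t H)
       | H : DTrm (fun e => ?P (e 0) (e 1)) |- DTrm (fun e => ?P (@?t e) (@?s e)) =>
           apply (DTrm_app2 P t s H)
       | H : Dfn (fun e => ?P (e 0) (fun i => e (S i))) |-
           Dfn (fun e => ?P (e ?k) (fun i => e (@?r i))) =>
           apply (Dfn_inst P k r H)
       | H : DTrm ?t |- DTrm (fun e => ?t (fun i => e (@?r i))) =>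
           apply (DTrm_ren t r H)
       end
     | dfn_set ]
  end.

Ltac dfn := repeat dfn_step.

(** * Descriptions and elementary set operations *)

Section Sets.
Context {M : set_structure} {HZF : ZF M}.

Lemma ext (x y : M) : (forall z : M, z ∈ x <-> z ∈ y) -> x = y.
Proof. apply (ZF_extensionality M HZF). Qed.

Lemma separation (P : M -> Prop) (a : M) :
  Dfn (fun e => P (e 0)) -> exists b : M, forall x, x ∈ b <-> x ∈ a /\ P x.
Proof.
  intros HP; destruct (Dfn_relation (fun x _ => P x) HP a) as (p & rho & H).
  destruct (ZF_separation M HZF p (scons a rho) a) as [b Hb].
  exists b; intros x; now rewrite Hb, (H x a).
Qed.

Lemma empty_exists : exists x : M, empty x.
Proof.
  destruct (ZF_infinity M HZF) as (_ & (e & He & _) & _); eauto.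
Qed.

Definition inhM : inhabited M :=
  match empty_exists with ex_intro _ x _ => inhabits x end.

(** The unique [y] such that [P y], or the empty set if there is none. *)
Definition iota (P : M -> Prop) : M :=
  epsilon inhM (fun y => (exists! x, P x) /\ P y \/ ~ (exists! x, P x) /\ empty y).

Lemma iota_graph (P : M -> Prop) (y : M) :
  y = iota P <-> (exists! x, P x) /\ P y \/ ~ (exists! x, P x) /\ empty y.
Proof.
  unfold iota.
  match goal with |- _ = epsilon _ ?Q <-> _ => assert (HQ : exists y, Q y) end.
  { destruct (classic (exists! x, P x)) as [H|H].
    - pose proof H as [x [Hx _]]; exists x; auto.
    - destruct empty_exists as [x Hx]; exists x; auto. }
  apply (epsilon_spec inhM) in HQ; revert HQ; generalize (epsilon inhM (fun y =>
    (exists! x, P x) /\ P y \/ ~ (exists! x, P x) /\ empty y)); intros w Hw.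
  split; [now intros ->|intros Hy].
  destruct Hw as [[H Hw]|[H Hw]], Hy as [[H' Hy]|[H' Hy]]; try contradiction.
  - destruct H as [x [_ H]]; now rewrite <- (H y Hy), <- (H w Hw).
  - apply ext; intros z; split; intros Hz; [now apply Hy in Hz|now apply Hw in Hz].
Qed.

Lemma iota_eq (P : M -> Prop) (y : M) :
  P y -> (forall z, P z -> z = y) -> iota P = y.
Proof.
  intros H H'; symmetry; apply iota_graph; left; split; [|assumption].
  exists y; split; [assumption|]; intros z Hz; symmetry; auto.
Qed.

Lemma iota_spec (P : M -> Prop) : (exists! x, P x) -> P (iota P).
Proof.
  intros H; destruct (proj1 (iota_graph P _) eq_refl) as [[_ H']|[H' _]]; tauto.
Qed.

Lemma DTrm_iota (P : M -> (nat -> M) -> Prop) :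
  Dfn (fun e => P (e 0) (fun i => e (S i))) ->
  DTrm (fun e => iota (fun y => P y e)).
Proof.
  intros HP; eapply Dfn_iff; [intros e; apply iota_graph|].
  unfold unique, empty; dfn.
Qed.

(** A proper class gets the empty set as its value; [in_cls] therefore asks for a set with the same
    members. *)
Definition cls (P : M -> Prop) : M := iota (fun y => forall z, z ∈ y <-> P z).

Lemma in_cls (P : M -> Prop) (z : M) :
  (exists y : M, forall z, z ∈ y <-> P z) -> z ∈ cls P <-> P z.
Proof.
  intros [y Hy]; unfold cls; rewrite (iota_eq _ y); auto.
  intros y' Hy'; apply ext; intros x; now rewrite Hy', Hy.
Qed.

Lemma DTrm_cls (P : M -> (nat -> M) -> Prop) :
  Dfn (fun e => P (e 0) (fun i => e (S i))) ->
  DTrm (fun e => cls (fun y => P y e)).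
Proof.
  intros HP; unfold cls; apply (DTrm_iota (fun y e => forall z, z ∈ y <-> P z e)).
  dfn.
Qed.

Definition emp : M := cls (fun _ => False).
Definition upr (a b : M) : M := cls (fun z => z = a \/ z = b).
Definition opr (a b : M) : M := upr (upr a a) (upr a b).
Definition Un (x : M) : M := cls (fun z => exists y, y ∈ x /\ z ∈ y).
Definition Pow (x : M) : M := cls (fun z => z ⊆ x).
Definition cup (a b : M) : M := cls (fun z => z ∈ a \/ z ∈ b).
Definition suc (x : M) : M := cls (fun z => z ∈ x \/ z = x).
Definition sep (a : M) (P : M -> Prop) : M := cls (fun z => z ∈ a /\ P z).
Definition im (F : M -> M) (a : M) : M := cls (fun y => exists x, x ∈ a /\ y = F x).
Definition lam (F : M -> M) (a : M) : M := im (fun x => opr x (F x)) a.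
Definition ap (f x : M) : M := iota (fun y => app f x y).
Definition prod (a b : M) : M := Un (im (fun x => im (fun y => opr x y) b) a).

Lemma in_emp (z : M) : ~ z ∈ emp.
Proof. unfold emp; rewrite in_cls; [auto|].
  destruct empty_exists as [x Hx]; exists x; intros w; split; [apply Hx|tauto].
Qed.

Lemma empty_emp (x : M) : empty x <-> x = emp.
Proof.
  split; [intros H; apply ext; intros z; split; intros Hz|intros -> z; apply in_emp].
  - now apply H in Hz.
  - now apply in_emp in Hz.
Qed.

Lemma nonemp (x : M) : x <> emp -> exists z, z ∈ x.
Proof.
  intros H; apply NNPP; intros H'; apply H, empty_emp; intros z Hz; eauto.
Qed.

Lemma in_upr (a b z : M) : z ∈ upr a b <-> z = a \/ z = b.
Proof. apply in_cls, (ZF_pairing M HZF). Qed.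

Lemma upair_upr (a b x : M) : upair a b x <-> x = upr a b.
Proof.
  split; [intros H; apply ext; intros z; now rewrite (H z), in_upr|].
  intros -> z; apply in_upr.
Qed.

Lemma opair_opr (a b p : M) : opair a b p <-> p = opr a b.
Proof.
  unfold opair, opr; split.
  - intros (s & t & Hs & Ht & Hp); apply upair_upr in Hs, Ht, Hp; now subst.
  - intros ->; exists (upr a a), (upr a b); now rewrite !upair_upr.
Qed.

Lemma upr_inj (a b c d : M) : upr a b = upr c d -> a = c /\ b = d \/ a = d /\ b = c.
Proof.
  intros H; assert (H' : forall z, z = a \/ z = b <-> z = c \/ z = d)
    by (intros z; now rewrite <- !in_upr, H).
  destruct (proj1 (H' a) (or_introl eq_refl)), (proj1 (H' b) (or_intror eq_refl)),
    (proj2 (H' c) (or_introl eq_refl)), (proj2 (H' d) (or_intror eq_refl));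
    subst; auto.
Qed.

Lemma opr_inj (a b c d : M) : opr a b = opr c d -> a = c /\ b = d.
Proof.
  intros H; apply upr_inj in H as [[H H']|[H H']];
    apply upr_inj in H; apply upr_inj in H'; intuition congruence.
Qed.

Lemma app_opr (f x y : M) : app f x y <-> opr x y ∈ f.
Proof.
  unfold app; split.
  - intros (p & Hp & H); apply opair_opr in Hp; now subst.
  - intros H; exists (opr x y); split; [now apply opair_opr|assumption].
Qed.

Lemma in_Un (x z : M) : z ∈ Un x <-> exists y, y ∈ x /\ z ∈ y.
Proof. apply in_cls, (ZF_union M HZF). Qed.

Lemma in_Pow (x z : M) : z ∈ Pow x <-> z ⊆ x.
Proof. apply (in_cls (fun z => z ⊆ x)), (ZF_powerset M HZF). Qed.

Lemma in_cup (a b z : M) : z ∈ cup a b <-> z ∈ a \/ z ∈ b.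
Proof.
  apply in_cls; exists (Un (upr a b)); intros w; rewrite in_Un; split.
  - intros (y & Hy & Hw); apply in_upr in Hy as [-> | ->]; auto.
  - intros [H|H]; [exists a|exists b]; rewrite in_upr; auto.
Qed.

Lemma in_suc (x z : M) : z ∈ suc x <-> z ∈ x \/ z = x.
Proof.
  apply in_cls; exists (cup x (upr x x)); intros w; rewrite in_cup, in_upr; tauto.
Qed.

Lemma succ_suc (x y : M) : succ x y <-> y = suc x.
Proof.
  split; [intros H; apply ext; intros z; now rewrite (H z), in_suc|].
  intros -> z; apply in_suc.
Qed.

Lemma in_sep (a : M) (P : M -> Prop) (z : M) :
  Dfn (fun e => P (e 0)) -> z ∈ sep a P <-> z ∈ a /\ P z.
Proof. intros H; apply in_cls, separation, H. Qed.

Lemma in_im (F : M -> M) (a y : M) :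
  DTrm (fun e => F (e 0)) -> y ∈ im F a <-> exists x, x ∈ a /\ y = F x.
Proof.
  intros HF; apply in_cls.
  assert (HR : Dfn (fun e => e 1 = F (e 0))) by (apply Dfn_eq; dfn).
  destruct (Dfn_relation (fun x y => y = F x) HR a) as (p & rho & H).
  destruct (ZF_replacement M HZF p rho a) as [b Hb].
  - intros x z z' _ Hz Hz'; apply H in Hz, Hz'; congruence.
  - exists b; intros z; rewrite Hb; split; intros (x & Hx & Hz); exists x;
      split; auto; now apply H.
Qed.

Lemma DTrm_upr (t s : (nat -> M) -> M) : DTrm t -> DTrm s -> DTrm (fun e => upr (t e) (s e)).
Proof.
  intros Ht Hs; unfold upr; apply (DTrm_cls (fun z e => z = t e \/ z = s e)); dfn.
Qed.

Lemma DTrm_opr (t s : (nat -> M) -> M) : DTrm t -> DTrm s -> DTrm (fun e => opr (t e) (s e)).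
Proof.
  intros Ht Hs; unfold opr; repeat apply DTrm_upr; assumption.
Qed.

Lemma DTrm_cup (t s : (nat -> M) -> M) : DTrm t -> DTrm s -> DTrm (fun e => cup (t e) (s e)).
Proof.
  intros Ht Hs; unfold cup; apply (DTrm_cls (fun z e => z ∈ t e \/ z ∈ s e)); dfn.
Qed.

Lemma DTrm_Un (t : (nat -> M) -> M) : DTrm t -> DTrm (fun e => Un (t e)).
Proof.
  intros Ht; unfold Un; apply (DTrm_cls (fun z e => exists y, y ∈ t e /\ z ∈ y)); dfn.
Qed.

Lemma DTrm_Pow (t : (nat -> M) -> M) : DTrm t -> DTrm (fun e => Pow (t e)).
Proof.
  intros Ht; unfold Pow, subset; apply (DTrm_cls (fun z e => forall y, y ∈ z -> y ∈ t e)); dfn.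
Qed.

Lemma DTrm_suc (t : (nat -> M) -> M) : DTrm t -> DTrm (fun e => suc (t e)).
Proof.
  intros Ht; unfold suc; apply (DTrm_cls (fun z e => z ∈ t e \/ z = t e)); dfn.
Qed.

Lemma DTrm_sep (t : (nat -> M) -> M) (P : M -> (nat -> M) -> Prop) :
  DTrm t -> Dfn (fun e => P (e 0) (fun i => e (S i))) ->
  DTrm (fun e => sep (t e) (fun z => P z e)).
Proof.
  intros Ht HP; unfold sep; apply (DTrm_cls (fun z e => z ∈ t e /\ P z e)); dfn.
Qed.

Lemma DTrm_im (t : (nat -> M) -> M) (F : M -> (nat -> M) -> M) :
  DTrm t -> DTrm (fun e => F (e 0) (fun i => e (S i))) ->
  DTrm (fun e => im (fun z => F z e) (t e)).
Proof.
  intros Ht HF; unfold im.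
  apply (DTrm_cls (fun y e => exists x, x ∈ t e /\ y = F x e)).
  apply (Dfn_ex (fun x e => x ∈ t (fun i => e (S i)) /\ e 0 = F x (fun i => e (S i)))).
  apply Dfn_and; [dfn|apply Dfn_eq; [dfn|]].
  exact (DTrm_ren _ (fun i => match i with 0 => 0 | S j => S (S j) end) HF).
Qed.

Lemma DTrm_lam (t : (nat -> M) -> M) (F : M -> (nat -> M) -> M) :
  DTrm t -> DTrm (fun e => F (e 0) (fun i => e (S i))) ->
  DTrm (fun e => lam (fun z => F z e) (t e)).
Proof.
  intros Ht HF; unfold lam; apply (DTrm_im t (fun z e => opr z (F z e))); [dfn|].
  apply DTrm_opr; dfn.
Qed.

Lemma Dfn_app_rel (f x y : (nat -> M) -> M) :
  DTrm f -> DTrm x -> DTrm y -> Dfn (fun e => app (f e) (x e) (y e)).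
Proof.
  intros Hf Hx Hy; eapply Dfn_iff; [intros e; apply app_opr|].
  apply Dfn_mem; [now apply DTrm_opr|assumption].
Qed.

Lemma DTrm_ap (t s : (nat -> M) -> M) : DTrm t -> DTrm s -> DTrm (fun e => ap (t e) (s e)).
Proof.
  intros Ht Hs; unfold ap; apply (DTrm_iota (fun y e => app (t e) (s e) y)).
  apply Dfn_app_rel; dfn.
Qed.

Lemma DTrm_prod (t s : (nat -> M) -> M) :
  DTrm t -> DTrm s -> DTrm (fun e => prod (t e) (s e)).
Proof.
  intros Ht Hs; unfold prod; apply DTrm_Un.
  apply (DTrm_im t (fun x e => im (fun y => opr x y) (s e))); [assumption|].
  apply (DTrm_im (fun e => s (fun i => e (S i))) (fun y e => opr (e 0) y)); [dfn|].
  apply DTrm_opr; dfn.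
Qed.

End Sets.

Ltac dfn_ordinal := fail.
Ltac dfn_set ::=
  lazymatch goal with
  | |- DTrm (fun e => iota _) => apply DTrm_iota
  | |- DTrm (fun e => cls _) => apply DTrm_cls
  | |- DTrm (fun e => upr _ _) => apply DTrm_upr
  | |- DTrm (fun e => opr _ _) => apply DTrm_opr
  | |- DTrm (fun e => cup _ _) => apply DTrm_cup
  | |- DTrm (fun e => Un _) => apply DTrm_Un
  | |- DTrm (fun e => Pow _) => apply DTrm_Pow
  | |- DTrm (fun e => suc _) => apply DTrm_suc
  | |- DTrm (fun e => ap _ _) => apply DTrm_ap
  | |- DTrm (fun e => prod _ _) => apply DTrm_prod
  | |- DTrm (fun e => sep _ _) => apply DTrm_sep
  | |- DTrm (fun e => lam _ _) => apply DTrm_lam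
  | |- DTrm (fun e => im _ _) => apply DTrm_im
  | |- Dfn (fun e => app _ _ _) => apply Dfn_app_rel
  | |- _ => dfn_ordinal
  end.

Notation DPred P := (Dfn (fun e => P (e 0))).
Notation DRel R := (Dfn (fun e => R (e 0) (e 1))).
Notation DFun F := (DTrm (fun e => F (e 0))).

(** * Functions *)

Section Functions.
Context {M : set_structure} {HZF : ZF M}.

(** The two images are described by equivalent conditions, so [iota_graph] gives both the same
    value. This works for arbitrary operations, which is convenient inside recursions. *)
Lemma im_ext (F G : M -> M) (a : M) :
  (forall x, x ∈ a -> F x = G x) -> im F a = im G a.
Proof.
  intros H; unfold im, cls, iota.
  assert (E : forall y, (forall z, z ∈ y <-> exists x, x ∈ a /\ z = F x) <->
                        (forall z, z ∈ y <-> exists x, x ∈ a /\ z = G x)).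
  { intros y; split; intros Hy z; rewrite Hy; split; intros (x & Hx & ->);
      exists x; split; auto; symmetry; auto. }
  apply iota_graph.
  destruct (proj1 (iota_graph (fun y => forall z, z ∈ y <-> exists x, x ∈ a /\ z = F x) _)
              eq_refl) as [[(y & Hy & Hu) H']|[H' H'']].
  - left; split; [|apply E, H'].
    exists y; split; [apply E, Hy|intros y' Hy'; apply Hu, E, Hy'].
  - right; split; [|apply H''].
    intros (y & Hy & Hu); apply H'; exists y.
    split; [apply E, Hy|intros y' Hy'; apply Hu, E, Hy'].
Qed.

Lemma app_lam (F : M -> M) (a x y : M) :
  DFun F -> app (lam F a) x y <-> x ∈ a /\ y = F x.
Proof.
  intros HF; rewrite app_opr; unfold lam; rewrite in_im by dfn; split.
  - intros (x' & Hx & H); apply opr_inj in H as [-> ->]; auto.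
  - intros [Hx ->]; eauto.
Qed.

Lemma fun_lam (F : M -> M) (a b : M) :
  DFun F -> (forall x, x ∈ a -> F x ∈ b) -> is_fun (lam F a) a b.
Proof.
  intros HF Hb; split.
  - intros p Hp; unfold lam in Hp; rewrite in_im in Hp by dfn.
    destruct Hp as (x & Hx & ->); exists x, (F x); rewrite opair_opr; auto.
  - intros x Hx; exists (F x); split; [now apply app_lam|].
    intros y Hy; apply app_lam in Hy; [|assumption]; now symmetry.
Qed.

Lemma fun_app (f a b x y : M) : is_fun f a b -> app f x y -> x ∈ a /\ y ∈ b.
Proof.
  intros [H _] Hp; apply app_opr, H in Hp as (x' & y' & Hx & Hy & Hp).
  apply opair_opr, opr_inj in Hp as [-> ->]; auto.
Qed.

Lemma ap_eq (f x y : M) : (forall z, app f x z <-> z = y) -> ap f x = y.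
Proof.
  intros H; apply iota_eq; [now apply H|]; intros z Hz; now apply H.
Qed.

Lemma ap_lam (F : M -> M) (a x : M) : DFun F -> x ∈ a -> ap (lam F a) x = F x.
Proof.
  intros HF Hx; apply ap_eq; intros z; rewrite app_lam by assumption; tauto.
Qed.

Lemma fun_ap (f a b x y : M) : is_fun f a b -> app f x y <-> x ∈ a /\ y = ap f x.
Proof.
  intros Hf; pose proof Hf as [_ H].
  assert (H' : forall x, x ∈ a -> app f x (ap f x)).
  { intros z Hz; unfold ap; apply iota_spec, H, Hz. }
  split.
  - intros Hp; pose proof (fun_app _ _ _ _ _ Hf Hp) as [Hx _]; split; [assumption|].
    destruct (H x Hx) as (w & _ & Hw); now rewrite <- (Hw y Hp), <- (Hw _ (H' x Hx)).
  - intros [Hx ->]; auto.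
Qed.

Lemma ap_in (f a b x : M) : is_fun f a b -> x ∈ a -> ap f x ∈ b.
Proof.
  intros Hf Hx; apply (fun_app f a b x (ap f x) Hf), (fun_ap f a b); auto.
Qed.

Definition maps (F : M -> M) (a b : M) : Prop := forall x, x ∈ a -> F x ∈ b.

Definition inj_on (F : M -> M) (a : M) : Prop :=
  forall x y, x ∈ a -> y ∈ a -> F x = F y -> x = y.

Definition onto (F : M -> M) (a b : M) : Prop :=
  forall y, y ∈ b -> exists x, x ∈ a /\ y = F x.

Lemma injection_lam (F : M -> M) (a b : M) :
  DFun F -> maps F a b -> inj_on F a -> is_injection (lam F a) a b.
Proof.
  intros HF Hm Hi; split; [now apply fun_lam|].
  intros x x' y Hx Hx'; apply app_lam in Hx, Hx'; auto; apply Hi; intuition congruence.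
Qed.

Lemma bijection_lam (F : M -> M) (a b : M) :
  DFun F -> maps F a b -> inj_on F a -> onto F a b -> is_bijection (lam F a) a b.
Proof.
  intros HF Hm Hi Ho; split; [now apply injection_lam|].
  intros y Hy; destruct (Ho y Hy) as (x & Hx & ->); exists x; now apply app_lam.
Qed.

(** Passes between functions that are elements of the model and definable operations on it; the
    constructions below work with the latter. *)
Lemma card_le_map (a b : M) :
  card_le a b <-> exists F, DFun F /\ maps F a b /\ inj_on F a.
Proof.
  split.
  - intros (f & Hf & Hi); exists (ap f); split; [dfn|split].
    + intros x; now apply ap_in.
    + intros x y Hx Hy E; apply (Hi x y (ap f x)); apply (fun_ap f a b); auto.
  - intros (F & HF & Hm & Hi); exists (lam F a); now apply injection_lam.
Qed.

Lemma equipotent_map (a b : M) :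
  equipotent a b <-> exists F, DFun F /\ maps F a b /\ inj_on F a /\ onto F a b.
Proof.
  split.
  - intros (f & (Hf & Hi) & Ho); exists (ap f); split; [dfn|split; [|split]].
    + intros x; now apply ap_in.
    + intros x y Hx Hy E; apply (Hi x y (ap f x)); apply (fun_ap f a b); auto.
    + intros y Hy; destruct (Ho y Hy) as (x & Hx).
      apply (fun_ap f a b) in Hx; eauto.
  - intros (F & HF & Hm & Hi & Ho); exists (lam F a); now apply bijection_lam.
Qed.

Lemma card_le_trans (a b c : M) : card_le a b -> card_le b c -> card_le a c.
Proof.
  rewrite !card_le_map; intros (F & HF & Hm & Hi) (G & HG & Hm' & Hi').
  exists (fun x => G (F x)); split; [dfn|split].
  - intros x Hx; auto.
  - intros x y Hx Hy E; auto.
Qed.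

Lemma card_le_subset (a b : M) : a ⊆ b -> card_le a b.
Proof.
  intros H; apply card_le_map; exists (fun x => x); split; [dfn|split].
  - intros x; apply H.
  - intros x y _ _ E; exact E.
Qed.

Lemma equipotent_refl (a : M) : equipotent a a.
Proof.
  apply equipotent_map; exists (fun x => x); split; [dfn|split; [|split]]; intros x; eauto.
Qed.

Lemma equipotent_card_le (a b : M) : equipotent a b -> card_le a b.
Proof. intros (f & Hf & _); now exists f. Qed.

Lemma equipotent_trans (a b c : M) : equipotent a b -> equipotent b c -> equipotent a c.
Proof.
  rewrite !equipotent_map; intros (F & HF & Hm & Hi & Ho) (G & HG & Hm' & Hi' & Ho').
  exists (fun x => G (F x)); split; [dfn|split; [|split]].
  - intros x Hx; auto.
  - intros x y Hx Hy E; auto.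
  - intros z Hz; destruct (Ho' z Hz) as (y & Hy & ->), (Ho y Hy) as (x & Hx & ->); eauto.
Qed.

Definition inv (F : M -> M) (a y : M) : M := iota (fun x => x ∈ a /\ y = F x).

Lemma DFun_inv (F : M -> M) (a : M) : DFun F -> DFun (inv F a).
Proof. intros HF; unfold inv; dfn. Qed.

Lemma inv_eq (F : M -> M) (a x : M) : inj_on F a -> x ∈ a -> inv F a (F x) = x.
Proof.
  intros Hi Hx; apply iota_eq; [auto|]; intros z [Hz E]; apply Hi; auto.
Qed.

Lemma equipotent_sym (a b : M) : equipotent a b -> equipotent b a.
Proof.
  rewrite !equipotent_map; intros (F & HF & Hm & Hi & Ho).
  exists (inv F a); split; [now apply DFun_inv|split; [|split]].
  - intros y Hy; destruct (Ho y Hy) as (x & Hx & ->); now rewrite inv_eq.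
  - intros y z Hy Hz E.
    destruct (Ho y Hy) as (x & Hx & ->), (Ho z Hz) as (w & Hw & ->).
    rewrite !inv_eq in E by assumption; congruence.
  - intros x Hx; exists (F x); rewrite inv_eq; auto.
Qed.

Lemma equipotent_im (F : M -> M) (a : M) :
  DFun F -> inj_on F a -> equipotent a (im F a).
Proof.
  intros HF Hi; apply equipotent_map; exists F; split; [assumption|split; [|split]].
  - intros x Hx; apply in_im; eauto.
  - assumption.
  - intros y Hy; now apply in_im in Hy.
Qed.

End Functions.

(** * Ordinals *)

Section Ordinals.
Context {M : set_structure} {HZF : ZF M}.

Lemma Dfn_subset (t s : (nat -> M) -> M) :
  DTrm t -> DTrm s -> Dfn (fun e => t e ⊆ s e).
Proof. intros Ht Hs; unfold subset; dfn. Qed.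

Lemma Dfn_empty (t : (nat -> M) -> M) : DTrm t -> Dfn (fun e => empty (t e)).
Proof. intros Ht; unfold empty; dfn. Qed.

Lemma Dfn_ordinal (t : (nat -> M) -> M) : DTrm t -> Dfn (fun e => ordinal (t e)).
Proof. intros Ht; unfold ordinal, transitive, subset; dfn. Qed.

Lemma Dfn_succ (t s : (nat -> M) -> M) :
  DTrm t -> DTrm s -> Dfn (fun e => succ (t e) (s e)).
Proof. intros Ht Hs; unfold succ; dfn. Qed.

Lemma Dfn_natural (t : (nat -> M) -> M) : DTrm t -> Dfn (fun e => natural (t e)).
Proof. intros Ht; unfold natural, ordinal, transitive, subset, empty, succ; dfn. Qed.

Lemma mem_irrefl (x : M) : ~ x ∈ x.
Proof.
  intros Hx; destruct (ZF_foundation M HZF (upr x x)) as (y & Hy & H).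
  - exists x; apply in_upr; auto.
  - apply in_upr in Hy; assert (y = x) as -> by tauto.
    apply (H x); [apply in_upr; auto|assumption].
Qed.

Lemma ord_in (a x : M) : ordinal a -> x ∈ a -> ordinal x.
Proof.
  intros [H H'] Hx; split; [now apply H'|]; intros y Hy; apply H'.
  now apply (H x).
Qed.

Lemma ord_trans (a x y : M) : ordinal a -> x ∈ y -> y ∈ a -> x ∈ a.
Proof. intros [H _] Hx Hy; now apply (H y). Qed.

Lemma ord_asym (a b : M) : ordinal a -> a ∈ b -> ~ b ∈ a.
Proof. intros Ha H H'; apply (mem_irrefl a), (ord_trans a a b); assumption. Qed.

Lemma ord_sub (a b : M) : ordinal b -> a ∈ b -> a ⊆ b.
Proof. intros [H _]; apply H. Qed.

Lemma ord_min (P : M -> Prop) (a : M) :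
  DPred P -> ordinal a -> P a ->
  exists b, ordinal b /\ P b /\ b ⊆ a /\ forall c, c ∈ b -> ~ P c.
Proof.
  intros HP Ha Pa; destruct (classic (exists b, b ∈ a /\ P b)) as [(b & Hb)|H].
  - destruct (ZF_foundation M HZF (sep a P)) as (c & Hc & H).
    + exists b; now apply in_sep.
    + apply in_sep in Hc; [|assumption]; destruct Hc as [Hc Pc].
      exists c; split; [now apply (ord_in a)|]; split; [assumption|split].
      * now apply ord_sub.
      * intros d Hd Pd; apply (H d); [|assumption].
        apply in_sep; [assumption|]; split; [now apply (ord_trans a d c)|assumption].
  - exists a; split; [assumption|split; [assumption|split; [now intros z|]]].
    intros c Hc Pc; eauto.
Qed.

Lemma ord_ind (P : M -> Prop) :
  DPred P -> (forall a, ordinal a -> (forall b, b ∈ a -> P b) -> P a) ->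
  forall a, ordinal a -> P a.
Proof.
  intros HP H a Ha; apply NNPP; intros Hn.
  destruct (ord_min (fun x => ~ P x) a) as (b & Hb & Pb & _ & H'); [dfn|auto..|].
  apply Pb, H; [assumption|]; intros c Hc; apply NNPP, H', Hc.
Qed.

Lemma ord_total (a b : M) : ordinal a -> ordinal b -> a ∈ b \/ a = b \/ b ∈ a.
Proof.
  intros Ha; revert b; revert a Ha.
  apply (ord_ind (fun a => forall b, ordinal b -> a ∈ b \/ a = b \/ b ∈ a)).
  { dfn; apply Dfn_ordinal; dfn. }
  intros a Ha IHa.
  apply (ord_ind (fun b => a ∈ b \/ a = b \/ b ∈ a)); [dfn|].
  intros b Hb IHb; apply NNPP; intros H.
  (* If [a] and [b] are incomparable, the two induction hypotheses put each member of one into the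
     other, so the two are equal. *)
  apply H; right; left; apply ext; intros z; split; intros Hz.
  - destruct (IHa z Hz b Hb) as [?|[->|?]]; [assumption|tauto|].
    exfalso; apply H; right; right; now apply (ord_trans a b z).
  - destruct (IHb z Hz) as [?|[<-|?]]; [|tauto|assumption].
    exfalso; apply H; left; now apply (ord_trans b a z).
Qed.

Lemma ord_subset (a b : M) : ordinal a -> ordinal b -> a ⊆ b <-> a ∈ b \/ a = b.
Proof.
  intros Ha Hb; split.
  - intros H; destruct (ord_total a b Ha Hb) as [?|[?|H']]; auto.
    now apply H, mem_irrefl in H'.
  - intros [H| ->]; [now apply ord_sub|now intros z].
Qed.

Lemma ord_notin (a b : M) : ordinal a -> ordinal b -> ~ a ∈ b <-> b ⊆ a.
Proof.
  intros Ha Hb; split.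
  - intros H; apply ord_subset; auto; destruct (ord_total a b Ha Hb) as [?|[?|?]]; auto.
    tauto.
  - intros H H'; apply H in H'; now apply mem_irrefl in H'.
Qed.

Lemma ord_intro (a : M) : transitive a -> (forall x, x ∈ a -> ordinal x) -> ordinal a.
Proof. intros H H'; split; [assumption|]; intros x Hx; now apply H'. Qed.

Lemma ord_suc (a : M) : ordinal a -> ordinal (suc a).
Proof.
  intros Ha; apply ord_intro.
  - intros x Hx z Hz; apply in_suc in Hx; apply in_suc; left.
    destruct Hx as [Hx| ->]; [now apply (ord_trans a z x)|assumption].
  - intros x Hx; apply in_suc in Hx as [Hx| ->]; [now apply (ord_in a)|assumption].
Qed.

Lemma suc_sub (a b : M) : ordinal b -> suc a ⊆ b <-> a ∈ b.
Proof.
  intros Hb; split.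
  - intros H; apply H, in_suc; auto.
  - intros H x Hx; apply in_suc in Hx as [Hx| ->]; [now apply (ord_trans b x a)|assumption].
Qed.

Lemma in_suc_sub (a b : M) : ordinal a -> ordinal b -> a ∈ suc b <-> a ⊆ b.
Proof. intros Ha Hb; rewrite in_suc, ord_subset; tauto. Qed.

Lemma ord_Un (x : M) : (forall a, a ∈ x -> ordinal a) -> ordinal (Un x).
Proof.
  intros H; apply ord_intro.
  - intros y Hy z Hz; apply in_Un in Hy as (a & Ha & Hy); apply in_Un.
    exists a; split; [assumption|]; apply (ord_trans a z y); auto.
  - intros y Hy; apply in_Un in Hy as (a & Ha & Hy); apply (ord_in a); auto.
Qed.

Lemma Un_upper (x a : M) : a ∈ x -> a ⊆ Un x.
Proof. intros Ha z Hz; apply in_Un; eauto. Qed.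

Lemma ord_emp : ordinal emp.
Proof.
  split; intros x Hx; now apply in_emp in Hx.
Qed.

Lemma emp_sub (a : M) : emp ⊆ a.
Proof. intros z Hz; now apply in_emp in Hz. Qed.

Lemma emp_in (a : M) : ordinal a -> a <> emp -> emp ∈ a.
Proof.
  intros Ha H; destruct (ord_total emp a ord_emp Ha) as [?|[?|Ha']]; auto.
  - now subst.
  - now apply in_emp in Ha'.
Qed.

Lemma subset_refl (a : M) : a ⊆ a.
Proof. now intros z. Qed.

Lemma subset_trans (a b c : M) : a ⊆ b -> b ⊆ c -> a ⊆ c.
Proof. intros H H' z Hz; auto. Qed.

Lemma ord_sub_in (a b c : M) : ordinal a -> ordinal b -> ordinal c ->
  a ⊆ b -> b ∈ c -> a ∈ c.
Proof.
  intros Ha Hb Hc H H'; apply ord_subset in H as [H| ->]; auto.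
  now apply (ord_trans c a b).
Qed.

Definition lst (P : M -> Prop) : M :=
  iota (fun a => (ordinal a /\ P a) /\ forall b, b ∈ a -> ~ P b).

Lemma lst_spec (P : M -> Prop) (a : M) :
  DPred P -> ordinal a -> P a ->
  ordinal (lst P) /\ P (lst P) /\ lst P ⊆ a /\ forall b, b ∈ lst P -> ~ P b.
Proof.
  intros HP Ha Pa; destruct (ord_min P a HP Ha Pa) as (b & Hb & Pb & Hba & H).
  assert (E : lst P = b).
  { apply iota_eq; [auto|]; intros c [[Hc Pc] H'].
    destruct (ord_total c b Hc Hb) as [H1|[H1|H1]]; auto.
    - now apply H in H1.
    - now apply H' in H1. }
  rewrite E; auto.
Qed.

Lemma lst_le (P : M -> Prop) (a : M) :
  DPred P -> ordinal a -> P a -> lst P ⊆ a.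
Proof. intros HP Ha Pa; now apply lst_spec. Qed.

Lemma DTrm_lst (P : M -> (nat -> M) -> Prop) :
  Dfn (fun e => P (e 0) (fun i => e (S i))) ->
  DTrm (fun e => lst (fun y => P y e)).
Proof.
  intros HP; unfold lst, ordinal, transitive, subset.
  apply DTrm_iota; dfn.
Qed.

End Ordinals.

Ltac dfn_rec := fail.
Ltac dfn_ordinal ::=
  lazymatch goal with
  | |- Dfn (fun e => _ ⊆ _) => apply Dfn_subset
  | |- Dfn (fun e => empty _) => apply Dfn_empty
  | |- Dfn (fun e => ordinal _) => apply Dfn_ordinal
  | |- Dfn (fun e => succ _ _) => apply Dfn_succ
  | |- Dfn (fun e => natural _) => apply Dfn_natural
  | |- DTrm (fun e => lst _) => apply DTrm_lst
  | |- DTrm (fun e => inv _ _ _) => unfold inv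
  | |- _ => dfn_rec
  end.

(** * Natural numbers and omega *)

Section Omega.
Context {M : set_structure} {HZF : ZF M}.

Lemma nat_ord (n : M) : natural n -> ordinal n.
Proof. now intros []. Qed.

Lemma nat_in (n m : M) : natural n -> m ∈ n -> natural m.
Proof.
  intros [Hn H] Hm; split; [now apply (ord_in n)|].
  intros k [Hk| ->]; apply H; auto; left; now apply (ord_trans n k m).
Qed.

Lemma nat_emp : natural emp.
Proof.
  split; [apply ord_emp|]; intros m [H| ->]; [now apply in_emp in H|].
  left; now apply empty_emp.
Qed.

Lemma nat_suc (n : M) : natural n -> natural (suc n).
Proof.
  intros Hn; split; [now apply ord_suc, nat_ord|]; intros m [H| ->].
  - destruct Hn as [_ Hn]; apply Hn; now apply in_suc.
  - right; exists n; now apply succ_suc.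
Qed.

Lemma nat_cases (n : M) : natural n -> n = emp \/ exists m, natural m /\ n = suc m.
Proof.
  intros Hn; pose proof Hn as [_ H]; destruct (H n) as [E|[m E]]; auto.
  - left; now apply empty_emp.
  - right; apply succ_suc in E; subst; exists m; split; [|reflexivity].
    apply (nat_in (suc m)); [assumption|]; apply in_suc; auto.
Qed.

Lemma nat_ind' (P : M -> Prop) :
  DPred P -> P emp -> (forall n, natural n -> P n -> P (suc n)) ->
  forall n, natural n -> P n.
Proof.
  intros HP H0 HS n Hn; pose proof (nat_ord n Hn) as Ho; revert Hn.
  apply (ord_ind (fun n => natural n -> P n)); [dfn| |assumption].
  intros a Ha IH Hn; destruct (nat_cases a Hn) as [->|(m & Hm & ->)]; auto.
  apply HS; [assumption|]; apply IH; [apply in_suc; auto|assumption].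
Qed.

Definition om : M := cls natural.

Lemma in_om (n : M) : n ∈ om <-> natural n.
Proof.
  apply in_cls.
  destruct (ZF_infinity M HZF) as (w & (x & Hx & Hxw) & Hw).
  apply empty_emp in Hx; subst.
  assert (H : forall n, natural n -> n ∈ w).
  { apply nat_ind'; [dfn|assumption|].
    intros k _ Hk; destruct (Hw k Hk) as (y & Hy & Hyw).
    apply succ_suc in Hy; now subst. }
  exists (sep w natural); intros z; rewrite in_sep by dfn; split; [tauto|auto].
Qed.

Lemma om_omega : is_omega om.
Proof. exact in_om. Qed.

Lemma omega_om (w : M) : is_omega w -> w = om.
Proof. intros H; apply ext; intros z; now rewrite (H z), in_om. Qed.

Lemma ord_om : ordinal om.
Proof.
  apply ord_intro.
  - intros n Hn m Hm; apply in_om in Hn; apply in_om; now apply (nat_in n).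
  - intros n Hn; now apply nat_ord, in_om.
Qed.

Lemma om_suc (n : M) : n ∈ om -> suc n ∈ om.
Proof. rewrite !in_om; apply nat_suc. Qed.

Lemma suc_inj (a b : M) : ordinal a -> ordinal b -> suc a = suc b -> a = b.
Proof.
  intros Ha Hb E.
  assert (H1 : a ∈ suc b) by (rewrite <- E; apply in_suc; auto).
  assert (H2 : b ∈ suc a) by (rewrite E; apply in_suc; auto).
  apply in_suc in H1 as [H1|H1], H2 as [H2|H2]; auto.
  now apply ord_asym in H1.
Qed.

Lemma om_not_nat (n : M) : natural n -> ~ om ⊆ n.
Proof.
  intros Hn H; apply (mem_irrefl n), H, in_om, Hn.
Qed.

End Omega.

(** * Transfinite recursion *)

Section Recursion.
Context {M : set_structure} {HZF : ZF M}.

(** An attempt at the recursion up to and including [a]. The step operation [H] sees only the set of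
    earlier values, which is all that the recursions below consult. *)
Definition approx (H : M -> M) (g a : M) : Prop :=
  forall b, b ∈ suc a -> ap g b = H (im (fun c => ap g c) b).

(** Described through its approximations, which are sets, so that the graph of the recursion is
    expressible by a formula. *)
Definition rec (H : M -> M) (a : M) : M :=
  iota (fun y => exists g, approx H g a /\ y = ap g a).

Lemma DTrm_rec (t : (nat -> M) -> M) (H : M -> (nat -> M) -> M) :
  DTrm t -> DTrm (fun e => H (e 0) (fun i => e (S i))) ->
  DTrm (fun e => rec (fun x => H x e) (t e)).
Proof.
  intros Ht HH; unfold rec, approx.
  apply (DTrm_iota (fun y e => exists g, (forall b, b ∈ suc (t e) ->
    ap g b = H (im (fun c => ap g c) b) e) /\ y = ap g (t e))).
  apply (Dfn_ex (fun g e => (forall b, b ∈ suc (t (fun i => e (S i))) ->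
    ap g b = H (im (fun c => ap g c) b) (fun i => e (S i))) /\ e 0 = ap g (t (fun i => e (S i))))).
  apply Dfn_and; [|dfn].
  apply (Dfn_all (fun b e => b ∈ suc (t (fun i => e (S (S i)))) ->
    ap (e 0) b = H (im (fun c => ap (e 0) c) b) (fun i => e (S (S i))))).
  apply Dfn_imp; [dfn|].
  apply Dfn_eq; [dfn|].
  apply (DTrm_app (fun x e => H x (fun i => e (S (S (S i)))))
    (fun e => im (fun c => ap (e 1) c) (e 0))); [|dfn].
  exact (DTrm_ren _ (fun i => match i with 0 => 0 | S j => S (S (S (S j))) end) HH).
Qed.

Context (H : M -> M) (DH : DFun H).

Lemma approx_le (g a b : M) : ordinal a -> approx H g a -> b ∈ suc a -> approx H g b.
Proof.
  intros Ha Hg Hb c Hc; apply Hg.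
  pose proof (ord_suc a Ha) as Hsa; pose proof (ord_in _ _ Hsa Hb) as Ho.
  apply in_suc in Hc as [Hc| ->]; [now apply (ord_trans _ c b)|assumption].
Qed.

Lemma approx_unique (g g' a : M) : ordinal a -> approx H g a -> approx H g' a ->
  ap g a = ap g' a.
Proof.
  intros Ha; revert a Ha.
  apply (ord_ind (fun a => approx H g a -> approx H g' a -> ap g a = ap g' a)).
  { unfold approx; dfn. }
  intros a Ha IH Hg Hg'.
  rewrite (Hg a), (Hg' a) by (apply in_suc; auto).
  f_equal; apply im_ext; intros b Hb.
  apply IH; [assumption|apply (approx_le g a)|apply (approx_le g' a)];
    auto; apply in_suc; auto.
Qed.

Lemma rec_approx (g a : M) : ordinal a -> approx H g a -> rec H a = ap g a.
Proof.
  intros Ha Hg; apply iota_eq; [eauto|]; intros z (g' & Hg' & ->).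
  now apply approx_unique.
Qed.

Lemma DFun_rec : DFun (rec H).
Proof. apply (DTrm_rec (fun e => e 0) (fun x _ => H x)); dfn. Qed.

(** Replacement turns [b] ↦ [H (im (rec H) b)] into a set function on [suc a]. It is an
    approximation because below [a] the values of [rec H] agree with those of the approximations
    given by the induction hypothesis. *)
Lemma approx_exists (a : M) : ordinal a -> exists g, approx H g a.
Proof.
  revert a; apply (ord_ind (fun a => exists g, approx H g a)).
  { unfold approx; dfn. }
  intros a Ha IH; pose proof DFun_rec as DR.
  set (G := fun b => H (im (rec H) b)).
  assert (DG : DFun G) by (unfold G; dfn).
  exists (lam G (suc a)); intros b Hb; rewrite ap_lam by assumption.
  unfold G at 1; f_equal; apply im_ext; intros c Hc.
  pose proof (ord_suc a Ha) as Hsa; pose proof (ord_in _ _ Hsa Hb) as Ho.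
  assert (Hca : c ∈ a).
  { apply in_suc in Hb as [Hb| ->]; [now apply (ord_trans a c b)|assumption]. }
  rewrite ap_lam; [|assumption|apply in_suc; auto].
  destruct (IH c Hca) as [g Hg].
  pose proof (ord_in _ _ Ha Hca) as Hoc.
  rewrite (rec_approx g c Hoc Hg), (Hg c) by (apply in_suc; auto).
  unfold G; f_equal; apply im_ext; intros d Hd; symmetry.
  apply rec_approx; [now apply (ord_in c)|].
  apply (approx_le g c); auto; apply in_suc; auto.
Qed.

Lemma rec_eq (a : M) : ordinal a -> rec H a = H (im (rec H) a).
Proof.
  intros Ha; destruct (approx_exists a Ha) as [g Hg].
  rewrite (rec_approx g a Ha Hg), (Hg a) by (apply in_suc; auto).
  f_equal; apply im_ext; intros b Hb; symmetry.
  apply rec_approx; [now apply (ord_in a)|].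
  apply (approx_le g a); auto; apply in_suc; auto.
Qed.

End Recursion.

Ltac dfn_card := fail.
Ltac dfn_rec ::=
  lazymatch goal with
  | |- DTrm (fun e => rec _ _) => apply DTrm_rec
  | |- DTrm (fun e => om) => apply DTrm_const
  | |- _ => dfn_card
  end.

(** * Order types and cardinals *)

Section Cardinals.
Context {M : set_structure} {HZF : ZF M}.

Lemma Dfn_is_fun (f a b : (nat -> M) -> M) :
  DTrm f -> DTrm a -> DTrm b -> Dfn (fun e => is_fun (f e) (a e) (b e)).
Proof.
  intros Hf Ha Hb; eapply Dfn_iff.
  { intros e; unfold is_fun; apply iff_refl. }
  unfold opair, upair, unique; dfn.
Qed.

Lemma Dfn_equipotent (a b : (nat -> M) -> M) :
  DTrm a -> DTrm b -> Dfn (fun e => equipotent (a e) (b e)).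
Proof.
  intros Ha Hb; unfold equipotent, is_bijection, is_injection.
  dfn; apply Dfn_is_fun; dfn.
Qed.

Definition incr_on (F : M -> M) (a : M) : Prop :=
  forall x y, x ∈ a -> y ∈ a -> x ∈ y -> F x ∈ F y.

Lemma incr_inj (F : M -> M) (a : M) : ordinal a -> incr_on F a -> inj_on F a.
Proof.
  intros Ha H x y Hx Hy E.
  destruct (ord_total x y) as [H'|[H'|H']]; auto; try (now apply (ord_in a));
    apply H in H'; auto; rewrite E in H'; now apply mem_irrefl in H'.
Qed.

Lemma incr_ge (F : M -> M) (a : M) : DFun F -> ordinal a ->
  (forall x, x ∈ a -> ordinal (F x)) -> incr_on F a -> forall x, x ∈ a -> x ⊆ F x.
Proof.
  intros HF Ha HO H x Hx; pose proof (ord_in _ _ Ha Hx) as Ho; revert x Ho Hx.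
  apply (ord_ind (fun x => x ∈ a -> x ⊆ F x)); [dfn|].
  intros x Ho IH Hx y Hy.
  assert (Hya : y ∈ a) by now apply (ord_trans a y x).
  apply (ord_sub_in y (F y) (F x)); auto; now apply (ord_in a).
Qed.

Lemma im_mono (F : M -> M) (a b : M) : DFun F -> a ⊆ b -> im F a ⊆ im F b.
Proof.
  intros HF H y Hy; apply in_im in Hy as (x & Hx & ->); [|assumption].
  apply in_im; eauto.
Qed.

Lemma in_im_intro (F : M -> M) (a x : M) : DFun F -> x ∈ a -> F x ∈ im F a.
Proof. intros HF Hx; apply in_im; eauto. Qed.

(** [F a] is the least element of [Y] which is not in [F[a]]. *)
Lemma order_type_exists (Y m : M) : ordinal m -> Y ⊆ m ->
  exists r F, ordinal r /\ r ⊆ m /\ DFun F /\ maps F r Y /\ onto F r Y /\ incr_on F r.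
Proof.
  intros Hm HY.
  set (F := rec (fun X => lst (fun z => z ∈ Y /\ z ∉ X))).
  assert (DF : DFun F) by (unfold F; dfn).
  assert (FE : forall a, ordinal a -> F a = lst (fun z => z ∈ Y /\ z ∉ im F a)).
  { intros a Ha; unfold F at 1; rewrite rec_eq; [reflexivity|dfn|assumption]. }
  assert (HYo : forall y, y ∈ Y -> ordinal y).
  { intros y Hy; apply (ord_in m); auto. }
  assert (F1 : forall a, ordinal a -> ~ Y ⊆ im F a -> F a ∈ Y /\ F a ∉ im F a).
  { intros a Ha H; rewrite (FE a Ha).
    assert (Hz : exists z, z ∈ Y /\ z ∉ im F a).
    { apply NNPP; intros H'; apply H; intros z Hz; apply NNPP; eauto. }
    destruct Hz as [z Hz].
    apply (lst_spec (fun z => z ∈ Y /\ z ∉ im F a) z); [dfn|apply HYo, Hz|assumption]. }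
  assert (F2 : forall a b, ordinal a -> ~ Y ⊆ im F a -> b ∈ a -> F b ∈ F a).
  { intros a b Ha H Hb; destruct (F1 a Ha H) as [H1 H2].
    pose proof (ord_in a b Ha Hb) as Hbo.
    assert (Hs : im F b ⊆ im F a) by (apply im_mono; [assumption|now apply ord_sub]).
    assert (Hs' : ~ Y ⊆ im F b) by (intros H'; apply H; now apply (subset_trans _ (im F b))).
    destruct (F1 b Hbo Hs') as [H3 H4].
    assert (H5 : F b ⊆ F a).
    { rewrite (FE b Hbo); apply lst_le; [dfn|now apply HYo|]; auto. }
    apply ord_subset in H5 as [?|H5]; auto.
    exfalso; apply H2; rewrite <- H5; now apply in_im_intro. }
  (* If [Y] were not exhausted by stage [m], [F] would be increasing on [suc m], giving [m ⊆ F m]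
     although [F m] lies in [Y] and hence in [m]. *)
  assert (Ex : Y ⊆ im F m).
  { apply NNPP; intros H.
    assert (Hlt : forall b, b ∈ suc m -> ~ Y ⊆ im F b).
    { intros b Hb H'; apply H; apply (subset_trans _ (im F b)); [assumption|].
      apply im_mono; [assumption|]; apply in_suc in Hb as [Hb| ->];
        [now apply ord_sub|apply subset_refl]. }
    assert (Hb : forall b, b ∈ suc m -> ordinal b).
    { intros b; now apply ord_in, ord_suc. }
    assert (Hge : m ⊆ F m).
    { apply (incr_ge F (suc m)); auto.
      - now apply ord_suc.
      - intros x Hx; apply HYo, F1; auto.
      - intros x y Hx Hy Hxy; apply F2; auto.
      - apply in_suc; auto. }
    apply (mem_irrefl (F m)), Hge, HY, F1; auto. }
  destruct (lst_spec (fun a => Y ⊆ im F a) m) as (H1 & H2 & H3 & H4); [dfn|auto..|].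
  exists (lst (fun a => Y ⊆ im F a)), F.
  split; [assumption|split; [assumption|split; [assumption|split; [|split]]]].
  - intros x Hx; apply F1; [now apply (ord_in _ _ H1)|auto].
  - intros y Hy; apply H2 in Hy; now apply in_im in Hy.
  - intros x y Hx Hy Hxy; apply F2; auto; now apply (ord_in _ _ H1).
Qed.

(** The image of [k] in [a] has an order type that is at most [a] and equipotent with [k]. This
    reduces injections to the bijections in the definition of a cardinal. *)
Lemma cardinal_not_le (k a : M) : cardinal k -> a ∈ k -> ~ card_le k a.
Proof.
  intros [Hk Hc] Ha H; apply card_le_map in H as (F & HF & Hm & Hi).
  pose proof (ord_in _ _ Hk Ha) as Hao.
  destruct (order_type_exists (im F k) a Hao) as (r & G & Hr & Hra & HG & Gm & Go & Gi).
  { intros y Hy; apply in_im in Hy as (x & Hx & ->); auto. }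
  apply (Hc r).
  - apply (ord_sub_in r a k); auto.
  - apply (equipotent_trans _ (im F k)).
    + apply equipotent_map; exists G; auto using incr_inj.
    + now apply equipotent_sym, equipotent_im.
Qed.

Lemma nat_not_equip_suc (n : M) : natural n -> ~ card_le (suc n) n.
Proof.
  revert n; apply nat_ind'.
  { unfold card_le, is_injection; dfn; apply Dfn_is_fun; dfn. }
  - intros H; apply card_le_map in H as (F & _ & Hm & _).
    apply (in_emp (F emp)), Hm, in_suc; auto.
  - intros n Hn IH H; apply IH; clear IH.
    apply card_le_map in H as (F & HF & Hm & Hi).
    (* Redirect the element sent to [n] to the value of the last element. *)
    set (G := fun x => iota (fun y => F x = n /\ y = F (suc n) \/ F x <> n /\ y = F x)).
    assert (G1 : forall x, F x = n -> G x = F (suc n)).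
    { intros x E; apply iota_eq; [auto|]; intros z [[_ ?]|[? _]]; tauto. }
    assert (G2 : forall x, F x <> n -> G x = F x).
    { intros x E; apply iota_eq; [auto|]; intros z [[? _]|[_ ?]]; tauto. }
    assert (Hlast : suc n ∈ suc (suc n)) by (apply in_suc; auto).
    assert (Hin : forall x, x ∈ suc n -> x ∈ suc (suc n)) by (intros; apply in_suc; auto).
    assert (Hne : forall x, x ∈ suc n -> x <> suc n).
    { intros x Hx ->; now apply mem_irrefl in Hx. }
    apply card_le_map; exists G; split; [unfold G; dfn|split].
    + intros x Hx; destruct (classic (F x = n)) as [E|E].
      * rewrite G1 by assumption.
        destruct (proj1 (in_suc n _) (Hm _ Hlast)) as [H|H]; [assumption|].
        exfalso; apply (Hne x Hx), Hi; auto; congruence.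
      * rewrite G2 by assumption.
        destruct (proj1 (in_suc n _) (Hm _ (Hin x Hx))) as [H|H]; [assumption|tauto].
    + intros x y Hx Hy E.
      destruct (classic (F x = n)) as [Ex|Ex], (classic (F y = n)) as [Ey|Ey].
      * apply Hi; auto; congruence.
      * rewrite (G1 x), (G2 y) in E by assumption.
        exfalso; apply (Hne y Hy); symmetry; apply Hi; auto.
      * rewrite (G2 x), (G1 y) in E by assumption.
        exfalso; apply (Hne x Hx); apply Hi; auto.
      * rewrite (G2 x), (G2 y) in E by assumption; apply Hi; auto.
Qed.

Lemma nat_card_le (n m : M) : natural n -> natural m -> card_le n m -> n ⊆ m.
Proof.
  intros Hn Hm H; apply ord_notin; [now apply nat_ord..|].
  intros Hmn; apply (nat_not_equip_suc m Hm).
  apply (card_le_trans _ n); [|assumption].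
  apply card_le_subset, suc_sub; [now apply nat_ord|assumption].
Qed.

Lemma finite_nat (n : M) : natural n -> finite n.
Proof.
  intros Hn; exists n; split; [assumption|apply equipotent_refl].
Qed.

End Cardinals.

Ltac dfn_seq := fail.
Ltac dfn_card ::=
  lazymatch goal with
  | |- Dfn (fun e => is_fun _ _ _) => apply Dfn_is_fun
  | |- Dfn (fun e => equipotent _ _) => apply Dfn_equipotent
  | |- Dfn (fun e => maps _ _ _) => unfold maps
  | |- Dfn (fun e => card_le _ _) => unfold card_le, is_injection
  | |- Dfn (fun e => finite _) => unfold finite
  | |- _ => dfn_seq
  end.

(** * The successor of an infinite cardinal *)

Section Successor.
Context {M : set_structure} {HZF : ZF M} {kappa mu : M}.
Context (Hkappa : infinite_cardinal kappa) (Hmu : successor_cardinal kappa mu).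

Lemma mu_ord : ordinal mu.
Proof. apply Hmu. Qed.

Lemma kappa_in : kappa ∈ mu.
Proof. now destruct Hmu as (_ & H & _). Qed.

Lemma mu_in (a : M) : a ∈ mu -> ordinal a.
Proof. apply ord_in, mu_ord. Qed.

Lemma om_kappa : om ⊆ kappa.
Proof.
  destruct Hkappa as [[Hk _] Hf].
  apply ord_notin; [assumption|apply ord_om|].
  intros H; apply Hf, finite_nat, in_om, H.
Qed.

Lemma om_in_mu : om ∈ mu.
Proof.
  apply (ord_sub_in om kappa mu); [apply ord_om|apply mu_in, kappa_in|apply mu_ord| |apply kappa_in].
  apply om_kappa.
Qed.

Lemma nat_in_mu (n : M) : natural n -> n ∈ mu.
Proof. intros Hn; apply (ord_trans mu n om mu_ord); [now apply in_om|apply om_in_mu]. Qed.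

Lemma mu_not_le (a : M) : a ∈ mu -> ~ card_le mu a.
Proof. apply cardinal_not_le, Hmu. Qed.

(** The least ordinal equipotent with [a] is a cardinal. Were it above [kappa], it would include
    [mu], and so would [a], contradicting [a ∈ mu]. *)
Lemma in_mu_le (a : M) : a ∈ mu -> card_le a kappa.
Proof.
  intros Ha; pose proof (mu_in a Ha) as Hao.
  pose proof (equipotent_refl a) as Hr.
  destruct (lst_spec (fun x => equipotent x a) a) as (H1 & H2 & H3 & H4);
    [dfn|assumption..|].
  set (c := lst (fun x => equipotent x a)) in *.
  assert (Hc : cardinal c).
  { split; [assumption|]; intros b Hb E; apply (H4 b Hb).
    now apply (equipotent_trans _ c). }
  apply (card_le_trans _ c); [now apply equipotent_card_le, equipotent_sym|].
  apply card_le_subset, ord_notin; [apply mu_in, kappa_in|assumption|].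
  intros Hkc; apply (mem_irrefl a), H3.
  now apply (proj2 (proj2 Hmu) c Hc Hkc).
Qed.

(** The only alternative is [suc a = mu], which is excluded because an infinite [a] absorbs one more
    element. *)
Lemma mu_suc (a : M) : a ∈ mu -> suc a ∈ mu.
Proof.
  intros Ha; pose proof (mu_in a Ha) as Hao.
  destruct (ord_total (suc a) mu) as [H|[H|H]]; [now apply ord_suc|apply mu_ord|assumption| |].
  2:{ apply in_suc in H as [H|H].
      - now apply (ord_asym a mu Hao Ha) in H.
      - subst; now apply mem_irrefl in Ha. }
  exfalso; apply (mu_not_le a Ha); rewrite <- H.
  assert (Hom : om ⊆ a).
  { apply ord_notin; [assumption|apply ord_om|]; intros Hn.
    apply om_suc in Hn; rewrite H in Hn.
    now apply (ord_asym om mu ord_om om_in_mu). }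
  (* Shift the natural numbers by one to make room for [a]. *)
  set (F := fun x => iota (fun y => x = a /\ y = emp \/
    x <> a /\ (x ∈ om /\ y = suc x \/ x ∉ om /\ y = x))).
  assert (F1 : F a = emp).
  { apply iota_eq; [auto|]; intros z [[_ ?]|[? _]]; tauto. }
  assert (F2 : forall x, x <> a -> x ∈ om -> F x = suc x).
  { intros x E E'; apply iota_eq; [auto|]; intros z ?; tauto. }
  assert (F3 : forall x, x <> a -> x ∉ om -> F x = x).
  { intros x E E'; apply iota_eq; [auto|]; intros z ?; tauto. }
  assert (Hna : forall x, x ∈ a -> x <> a).
  { intros x Hx ->; now apply mem_irrefl in Hx. }
  assert (Hsn : forall x, suc x <> emp).
  { intros x E; apply (in_emp x); rewrite <- E; apply in_suc; auto. }
  assert (He : emp ∈ om) by apply in_om, nat_emp.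
  apply card_le_map; exists F; split; [unfold F; dfn|split].
  - intros x Hx; apply in_suc in Hx as [Hx| ->].
    + destruct (classic (x ∈ om)) as [E|E].
      * rewrite F2 by auto; now apply Hom, om_suc.
      * rewrite F3 by auto; assumption.
    + rewrite F1; now apply Hom.
  - intros x y Hx Hy E.
    assert (Hx' : x ∈ a /\ x ∈ om \/ x ∈ a /\ x ∉ om \/ x = a).
    { apply in_suc in Hx as [Hx| ->]; [|auto]; destruct (classic (x ∈ om)); auto. }
    assert (Hy' : y ∈ a /\ y ∈ om \/ y ∈ a /\ y ∉ om \/ y = a).
    { apply in_suc in Hy as [Hy| ->]; [|auto]; destruct (classic (y ∈ om)); auto. }
    destruct Hx' as [[X1 X2]|[[X1 X2]| ->]], Hy' as [[Y1 Y2]|[[Y1 Y2]| ->]];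
      repeat first [rewrite F1 in E | rewrite F2 in E by auto | rewrite F3 in E by auto].
    + apply suc_inj; auto; now apply nat_ord, in_om.
    + exfalso; apply Y2; rewrite <- E; now apply om_suc.
    + now apply Hsn in E.
    + exfalso; apply X2; rewrite E; now apply om_suc.
    + assumption.
    + now subst.
    + symmetry in E; now apply Hsn in E.
    + now subst.
    + reflexivity.
Qed.

(** * Regularity and unbounded subsets of the successor cardinal *)

Definition regular : Prop :=
  forall (d : M) (F : M -> M), d ∈ mu -> DFun F -> maps F d mu ->
    exists b, b ∈ mu /\ forall i, i ∈ d -> F i ∈ b.

Lemma is_cf_regular : is_cf mu mu -> regular.
Proof.
  intros (_ & _ & H) d F Hd HF Hm; apply NNPP; intros Hn.
  apply (mem_irrefl d), (H d); [now apply mu_in| |assumption].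
  exists (lam F d); split; [now apply fun_lam|]; intros x Hx.
  apply NNPP; intros Hn'; apply Hn; exists x; split; [assumption|].
  intros i Hi; apply NNPP; intros Hx'; apply Hn'; exists i, (F i).
  rewrite app_lam by assumption; split; [auto|].
  apply ord_notin; auto using mu_in.
Qed.

Lemma mu_cofinal : has_cofinal_map mu mu.
Proof.
  exists (lam (fun x => x) mu); split; [apply fun_lam; [dfn|auto]|].
  intros x Hx; exists x, x; rewrite app_lam by dfn; split; [auto|apply subset_refl].
Qed.

Lemma singular : ~ is_cf mu mu -> exists d, d ∈ mu /\ has_cofinal_map d mu.
Proof.
  intros Hn; apply NNPP; intros H; apply Hn; split; [apply mu_ord|split].
  - apply mu_cofinal.
  - intros d Hd Hc; apply ord_notin; [assumption|apply mu_ord|]; eauto.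
Qed.

(** [I a] is the least index whose value reaches [a]. An index that serves [b] serves every [a ⊆ b],
    whence monotonicity. *)
Lemma cofinal_index (d : M) : ordinal d -> has_cofinal_map d mu ->
  exists F I : M -> M, DFun F /\ DFun I /\ maps F d mu /\ maps I mu d /\
    (forall a, a ∈ mu -> a ⊆ F (I a)) /\
    (forall a b, a ∈ mu -> b ∈ mu -> a ⊆ b -> I a ⊆ I b).
Proof.
  intros Hd (f & Hf & Hc).
  set (I := fun a => lst (fun i => i ∈ d /\ a ⊆ ap f i)).
  assert (Sp : forall a, a ∈ mu -> I a ∈ d /\ a ⊆ ap f (I a)).
  { intros a Ha; destruct (Hc a Ha) as (i & y & Hi & Hay).
    apply (fun_ap f d mu) in Hi as [Hi ->]; [|assumption].
    apply (lst_spec (fun i => i ∈ d /\ a ⊆ ap f i) i); [dfn|now apply (ord_in d)|auto]. }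
  exists (ap f), I; split; [dfn|split; [unfold I; dfn|split; [|split; [|split]]]].
  - intros i; now apply ap_in.
  - intros a Ha; now apply Sp.
  - intros a Ha; now apply Sp.
  - intros a b Ha Hb Hab; destruct (Sp b Hb) as [H1 H2].
    unfold I at 1; apply lst_le; [dfn|now apply (ord_in d)|].
    split; [assumption|]; now apply (subset_trans _ b).
Qed.

Definition unbounded (P : M -> Prop) : Prop :=
  forall b, b ∈ mu -> exists a, a ∈ mu /\ P a /\ b ⊆ a.

Lemma not_unbounded (P : M -> Prop) :
  ~ unbounded P <-> exists b, b ∈ mu /\ forall a, a ∈ mu -> P a -> a ∈ b.
Proof.
  split.
  - intros H; apply NNPP; intros H'; apply H; intros b Hb.
    apply NNPP; intros H''; apply H'; exists b; split; [assumption|].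
    intros a Ha Pa; apply NNPP; intros Hn; apply H''; exists a; split; [assumption|].
    split; [assumption|]; apply ord_notin; auto using mu_in.
  - intros (b & Hb & H) H'; destruct (H' b Hb) as (a & Ha & Pa & Hba).
    specialize (H a Ha Pa); apply (mem_irrefl a), Hba, H.
Qed.

Lemma bounded_le (X b : M) : b ∈ mu -> X ⊆ b -> card_le X kappa.
Proof.
  intros Hb H; apply (card_le_trans _ b); [now apply card_le_subset|now apply in_mu_le].
Qed.

(** [S] is enumerated by recursion, for [mu] steps or until it is exhausted. *)
Lemma choice_dichotomy (S : M) (L : M -> M) : DFun L ->
  (forall X, X ⊆ S -> X <> emp -> L X ∈ X) -> card_le mu S \/ card_le S kappa.
Proof.
  intros DL HL.
  set (F := rec (fun X => L (sep S (fun z => z ∉ X)))).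
  assert (DF : DFun F) by (unfold F; dfn).
  assert (FE : forall a, ordinal a -> F a = L (sep S (fun z => z ∉ im F a))).
  { intros a Ha; unfold F at 1; rewrite rec_eq; [reflexivity|dfn|assumption]. }
  destruct (classic (exists a, a ∈ mu /\ S ⊆ im F a)) as [(a & Ha & H)|H].
  - right; apply (card_le_trans _ a); [|now apply in_mu_le].
    (* Taking the least stage at which an element is listed gives an injection into [a]. *)
    assert (Sp : forall s, s ∈ S -> lst (fun b => b ∈ a /\ s = F b) ∈ a /\
                    s = F (lst (fun b => b ∈ a /\ s = F b))).
    { intros s Hs; apply H, in_im in Hs as (b & Hb & ->); [|assumption].
      apply (lst_spec (fun b' => b' ∈ a /\ F b = F b') b); [dfn| |auto].
      apply (ord_in a); [now apply mu_in|assumption]. }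
    apply card_le_map; exists (fun s => lst (fun b => b ∈ a /\ s = F b)).
    split; [dfn|split].
    + intros s Hs; now apply Sp.
    + intros s t Hs Ht E.
      rewrite (proj2 (Sp s Hs)), (proj2 (Sp t Ht)); now rewrite E.
  - left.
    assert (F1 : forall a, a ∈ mu -> F a ∈ S /\ F a ∉ im F a).
    { intros a Ha.
      assert (Hin : F a ∈ sep S (fun z => z ∉ im F a)).
      { rewrite FE by now apply mu_in.
        apply HL.
        - intros z Hz; apply in_sep in Hz; [tauto|dfn].
        - intros E; apply H; exists a; split; [assumption|]; intros z Hz.
          apply NNPP; intros Hn; apply (in_emp z); rewrite <- E; apply in_sep; [dfn|auto]. }
      now apply in_sep in Hin; [|dfn]. }
    apply card_le_map; exists F; split; [assumption|split].
    + intros a Ha; now apply F1.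
    + intros a b Ha Hb E.
      destruct (ord_total a b) as [H'|[H'|H']]; auto using mu_in.
      * exfalso; apply (F1 b Hb); rewrite <- E; now apply in_im_intro.
      * exfalso; apply (F1 a Ha); rewrite E; now apply in_im_intro.
Qed.

Section Regular.
Context (Hreg : regular).

(** Each [s] has a least bound, so nothing has to be chosen. Transported along an injection [E] of
    [S] into [kappa], these bounds give a map from [kappa] to [mu], which is bounded by
    regularity. *)
Lemma reg_union (S : M) (P : M -> M -> Prop) : card_le S kappa -> DRel P ->
  (forall s, s ∈ S -> ~ unbounded (P s)) -> ~ unbounded (fun a => exists s, s ∈ S /\ P s a).
Proof.
  intros HS DP H; apply card_le_map in HS as (E & DE & Em & Ei).
  set (Q := fun i b => b ∈ mu /\ forall s, s ∈ S -> E s = i -> forall a, a ∈ mu -> P s a -> a ∈ b).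
  assert (DQ : DRel Q) by (unfold Q; dfn).
  assert (Sp : forall i, i ∈ kappa -> Q i (lst (Q i))).
  { intros i Hi; assert (Hex : exists b, Q i b).
    { destruct (classic (exists s, s ∈ S /\ E s = i)) as [(s & Hs & Hsi)|Hn].
      - destruct (proj1 (not_unbounded _) (H s Hs)) as (b & Hb & Hb').
        exists b; split; [assumption|]; intros t Ht Hti.
        rewrite (Ei t s) by congruence; assumption.
      (* Indices outside the range of [E] are subject to no condition, and [kappa] serves as a
         default bound. *)
      - exists kappa; split; [apply kappa_in|]; intros s Hs Hsi; exfalso; eauto. }
    destruct Hex as (b & Hb); apply (lst_spec (Q i) b); [dfn|apply mu_in, Hb|assumption]. }
  destruct (Hreg kappa (fun i => lst (Q i)) kappa_in) as (b & Hb & Hb').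
  { apply (DTrm_lst (fun b e => Q (e 0) b)); dfn. }
  { intros i Hi; now apply Sp. }
  apply not_unbounded; exists b; split; [assumption|]; intros a Ha (s & Hs & Hsa).
  pose proof (Em s Hs) as Hes; destruct (Sp _ Hes) as [_ H'].
  apply (ord_trans b a (lst (Q (E s)))); [now apply mu_in| |now apply Hb'].
  now apply (H' s Hs eq_refl).
Qed.

Lemma pigeonhole (S : M) (F : M -> M) (P : M -> Prop) :
  card_le S kappa -> DFun F -> DPred P -> unbounded P ->
  (forall a, a ∈ mu -> P a -> F a ∈ S) ->
  exists s, s ∈ S /\ unbounded (fun a => P a /\ F a = s).
Proof.
  intros HS DF DP HP Hm; apply NNPP; intros H.
  apply (reg_union S (fun s a => P a /\ F a = s) HS); [dfn|eauto|].
  intros b Hb; destruct (HP b Hb) as (a & Ha & Pa & Hab).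
  exists a; repeat split; auto; exists (F a); auto.
Qed.

(** The order type of [X] is at most [mu]; were it smaller, regularity would bound its
    enumeration. *)
Lemma unbounded_enum (X : M) : X ⊆ mu -> unbounded (fun a => a ∈ X) ->
  exists F, DFun F /\ maps F mu X /\ onto F mu X /\ incr_on F mu.
Proof.
  intros HX HU.
  destruct (order_type_exists X mu mu_ord HX) as (r & F & Hr & Hrm & DF & Fm & Fo & Fi).
  apply ord_subset in Hrm as [Hrm| ->]; [|eauto|assumption|apply mu_ord].
  destruct (Hreg r F Hrm DF) as (b & Hb & Hb'); [intros i Hi; auto|].
  exfalso; revert HU; apply not_unbounded; exists b; split; [assumption|].
  intros a Ha HaX; destruct (Fo a HaX) as (i & Hi & ->); auto.
Qed.

Lemma unbounded_equip (X : M) : X ⊆ mu -> unbounded (fun a => a ∈ X) -> equipotent mu X.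
Proof.
  intros HX HU; destruct (unbounded_enum X HX HU) as (F & DF & Fm & Fo & Fi).
  apply equipotent_map; exists F; auto using incr_inj, mu_ord.
Qed.

(** Converts the strict bound on branching into a usable one: the image of [c] in [mu] is bounded,
    as otherwise its enumeration would make [c] equipotent with [mu]. *)
Lemma reg_card_lt (c : M) : card_lt c mu -> card_le c kappa.
Proof.
  intros [H Hn]; apply card_le_map in H as (F & DF & Fm & Fi).
  assert (HX : im F c ⊆ mu).
  { intros y Hy; apply in_im in Hy as (x & Hx & ->); auto. }
  destruct (classic (unbounded (fun a => a ∈ im F c))) as [HU|HU].
  - exfalso; apply Hn, (equipotent_trans _ (im F c)); [now apply equipotent_im|].
    now apply equipotent_sym, unbounded_equip.
  - apply not_unbounded in HU as (b & Hb & HU).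
    apply (card_le_trans _ (im F c)); [now apply equipotent_card_le, equipotent_im|].
    apply (bounded_le _ b); [assumption|]; intros y Hy; apply HU; auto.
Qed.

Lemma mu_unbounded : unbounded (fun _ => True).
Proof.
  intros b Hb; exists b; split; [assumption|split; [auto|apply subset_refl]].
Qed.

Lemma reg_Un (d : M) (F : M -> M) : d ∈ mu -> DFun F -> maps F d mu -> Un (im F d) ∈ mu.
Proof.
  intros Hd DF Fm; destruct (Hreg d F Hd DF Fm) as (b & Hb & H).
  apply (ord_sub_in _ b mu); [|now apply mu_in|apply mu_ord| |assumption].
  - apply ord_Un; intros a Ha; apply in_im in Ha as (i & Hi & ->); auto.
    apply mu_in; auto.
  - intros z Hz; apply in_Un in Hz as (a & Ha & Hz).
    apply in_im in Ha as (i & Hi & ->); [|assumption].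
    apply (ord_trans b z (F i)); auto; now apply mu_in.
Qed.

(** * Finite sequences and trees *)

Lemma seq_mem (s n z : M) : ord_seq s n -> z ∈ s <-> exists x, x ∈ n /\ z = opr x (ap s x).
Proof.
  intros (Hn & b & Hb & Hs); split.
  - intros Hz; pose proof Hs as [H _]; destruct (H z Hz) as (x & y & Hx & Hy & Hp).
    apply opair_opr in Hp; subst; exists x; split; [assumption|].
    apply app_opr, (fun_ap s n b) in Hz as [_ ->]; auto.
  - intros (x & Hx & ->); apply app_opr, (fun_ap s n b); auto.
Qed.

Lemma seq_app (s n x y : M) : ord_seq s n -> app s x y <-> x ∈ n /\ y = ap s x.
Proof. intros (Hn & b & Hb & Hs); now apply (fun_ap s n b). Qed.

Lemma seq_ord (s n x : M) : ord_seq s n -> x ∈ n -> ordinal (ap s x).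
Proof. intros (Hn & b & Hb & Hs) Hx; now apply Hb, (ap_in s n b). Qed.

Lemma seq_ext (s t n : M) : ord_seq s n -> ord_seq t n ->
  (forall x, x ∈ n -> ap s x = ap t x) -> s = t.
Proof.
  intros Hs Ht H; apply ext; intros z; rewrite (seq_mem s n), (seq_mem t n) by assumption.
  split; intros (x & Hx & ->); exists x; split; auto; now rewrite H.
Qed.

Lemma seq_lam (F : M -> M) (n : M) : natural n -> DFun F ->
  (forall x, x ∈ n -> ordinal (F x)) -> ord_seq (lam F n) n.
Proof.
  intros Hn DF H; split; [assumption|]; exists (im F n); split.
  - intros a Ha; apply in_im in Ha as (x & Hx & ->); auto.
  - apply fun_lam; [assumption|]; intros x Hx; now apply in_im_intro.
Qed.

Lemma seq_sub (s t n m : M) : ord_seq s n -> ord_seq t m -> t ⊆ s ->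
  m ⊆ n /\ forall x, x ∈ m -> ap t x = ap s x.
Proof.
  intros Hs Ht H.
  assert (H' : forall x, x ∈ m -> x ∈ n /\ ap t x = ap s x).
  { intros x Hx; apply (seq_app s n); [assumption|].
    apply app_opr, H, app_opr, (seq_app t m); auto. }
  split; intros x Hx; now apply H'.
Qed.

Definition len (s : M) : M := iota (fun n => ord_seq s n).

Lemma len_eq (s n : M) : ord_seq s n -> len s = n.
Proof.
  intros Hs; apply iota_eq; [assumption|]; intros m Hm.
  destruct (seq_sub s s n m), (seq_sub s s m n); auto using subset_refl.
  apply ext; intros z; split; auto.
Qed.

Lemma Dfn_ord_seq (s n : (nat -> M) -> M) :
  DTrm s -> DTrm n -> Dfn (fun e => ord_seq (s e) (n e)).
Proof. intros Hs Hn; unfold ord_seq; dfn. Qed.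

Lemma Dfn_snoc (s a t : (nat -> M) -> M) :
  DTrm s -> DTrm a -> DTrm t -> Dfn (fun e => snoc (s e) (a e) (t e)).
Proof.
  intros Hs Ha Ht; unfold snoc, opair, upair; dfn; apply Dfn_ord_seq; dfn.
Qed.

Lemma DTrm_len (s : (nat -> M) -> M) : DTrm s -> DTrm (fun e => len (s e)).
Proof. intros Hs; unfold len; dfn; apply Dfn_ord_seq; dfn. Qed.

Ltac dfn_seq ::=
  lazymatch goal with
  | |- Dfn (fun e => ord_seq _ _) => apply Dfn_ord_seq
  | |- Dfn (fun e => snoc _ _ _) => apply Dfn_snoc
  | |- DTrm (fun e => len _) => apply DTrm_len
  end.

Lemma seq_snoc (s t n : M) : ord_seq s n -> ord_seq t (suc n) ->
  (forall x, x ∈ n -> ap t x = ap s x) -> snoc s (ap t n) t.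
Proof.
  intros Hs Ht H; exists n, (opr n (ap t n)); split; [assumption|].
  split; [now apply opair_opr|]; intros z.
  rewrite (seq_mem t (suc n)), (seq_mem s n) by assumption; split.
  - intros (x & Hx & ->); apply in_suc in Hx as [Hx| ->]; [left|auto].
    exists x; split; [assumption|]; now rewrite H.
  - intros [(x & Hx & ->)| ->].
    + exists x; rewrite in_suc; split; [auto|]; now rewrite H.
    + exists n; rewrite in_suc; auto.
Qed.

Lemma snoc_sub (s a t n : M) : ord_seq s n -> snoc s a t -> s ⊆ t /\ app t n a.
Proof.
  intros Hs (m & p & Hm & Hp & H); apply opair_opr in Hp.
  apply len_eq in Hm; rewrite (len_eq s n Hs) in Hm; subst.
  split; [intros z Hz; apply H; auto|]; apply app_opr, H; auto.
Qed.

(** The shortlex order; comparing lengths first is what makes it well-founded. *)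
Definition lex (s t : M) : Prop :=
  len s ∈ len t \/ len s = len t /\ exists i, i ∈ len s /\
    (forall j, j ∈ i -> ap s j = ap t j) /\ ap s i ∈ ap t i.

Lemma lex_asym (s t : M) : fin_ord_seq s -> fin_ord_seq t -> lex s t -> ~ lex t s.
Proof.
  intros [n Hs] [m Ht]; unfold lex; rewrite (len_eq s n Hs), (len_eq t m Ht).
  pose proof (nat_ord n (proj1 Hs)) as Hn; pose proof (nat_ord m (proj1 Ht)) as Hm.
  intros [H|[E (i & Hi & Hij & H)]] [H'|[E' (j & Hj & Hji & H')]].
  - now apply ord_asym in H.
  - subst; now apply mem_irrefl in H.
  - subst; now apply mem_irrefl in H'.
  - subst n; destruct (ord_total i j) as [L|[L|L]]; try now apply (ord_in m).
    + rewrite (Hji i L) in H; now apply mem_irrefl in H.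
    + subst j; apply ord_asym in H; [contradiction|now apply (seq_ord s m)].
    + rewrite (Hij j L) in H'; now apply mem_irrefl in H'.
Qed.

Lemma lex_min (X : M) : (forall s, s ∈ X -> fin_ord_seq s) -> X <> emp ->
  exists s, s ∈ X /\ forall t, t ∈ X -> t = s \/ lex s t.
Proof.
  intros HX Hne; apply nonemp in Hne as [s0 Hs0]; destruct (HX s0 Hs0) as [n0 Hn0].
  destruct (lst_spec (fun n => exists s, s ∈ X /\ ord_seq s n) n0)
    as (Hno & (s1 & Hs1 & Hn1) & _ & _); [dfn|apply nat_ord, Hn0|eauto|].
  set (n := lst (fun n => exists s, s ∈ X /\ ord_seq s n)) in *.
  pose proof (proj1 Hn1) as Hn.
  (* Among the sequences of minimal length [n], one coordinate is minimised at a time: after [k]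
     steps [s] is least with respect to its first [k] values. *)
  assert (Key : forall k, natural k -> k ⊆ n -> exists s, s ∈ X /\ ord_seq s n /\
    forall t, t ∈ X -> ord_seq t n -> (forall j, j ∈ k -> ap s j = ap t j) \/
      exists i, i ∈ k /\ (forall j, j ∈ i -> ap s j = ap t j) /\ ap s i ∈ ap t i).
  { apply (nat_ind' (fun k => k ⊆ n -> exists s, s ∈ X /\ ord_seq s n /\
      forall t, t ∈ X -> ord_seq t n -> (forall j, j ∈ k -> ap s j = ap t j) \/
      exists i, i ∈ k /\ (forall j, j ∈ i -> ap s j = ap t j) /\ ap s i ∈ ap t i)).
    { dfn. }
    - intros _; exists s1; split; [assumption|split; [assumption|]].
      intros t Ht Htn; left; intros j Hj; now apply in_emp in Hj.
    - intros k Hk IH Hkn; pose proof (proj1 (suc_sub k n Hno) Hkn) as Hkin.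
      destruct IH as (s & HsX & Hs & H); [now apply ord_sub|].
      (* Keep the first [k] values of [s] and take the least possible value at [k]. *)
      set (P := fun a => exists t, t ∈ X /\ ord_seq t n /\
        (forall j, j ∈ k -> ap s j = ap t j) /\ ap t k = a).
      destruct (lst_spec P (ap s k)) as (Ho & (t & HtX & Ht & Hst & Et) & _ & _).
      { unfold P; dfn. } { now apply (seq_ord s n). } { exists s; auto. }
      exists t; split; [assumption|split; [assumption|]]; intros u HuX Hu.
      destruct (H u HuX Hu) as [H1|(i & Hi & Hij & H1)].
      + assert (Hle : ap t k ⊆ ap u k).
        { rewrite Et; apply lst_le; [unfold P; dfn|now apply (seq_ord u n)|]; exists u; auto. }
        assert (Htu : forall j, j ∈ k -> ap t j = ap u j).
        { intros j Hj; now rewrite <- Hst, H1. }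
        apply ord_subset in Hle as [Hlt|E]; [| |now apply (seq_ord _ n)..].
        * right; exists k; rewrite in_suc; auto.
        * left; intros j Hj; apply in_suc in Hj as [Hj| ->]; auto.
      + right; exists i; rewrite in_suc; split; [auto|].
        pose proof (nat_ord k Hk) as Hko.
        split.
        * intros j Hj; rewrite <- Hst; [auto|]; now apply (ord_trans k j i).
        * now rewrite <- Hst. }
  destruct (Key n Hn (subset_refl n)) as (s & HsX & Hs & H).
  exists s; split; [assumption|]; intros t HtX; destruct (HX t HtX) as [m Ht].
  unfold lex; rewrite (len_eq s n Hs), (len_eq t m Ht).
  assert (Hnm : n ⊆ m).
  { apply lst_le; [dfn|apply nat_ord, Ht|eauto]. }
  apply ord_subset in Hnm as [Hnm| <-]; auto using nat_ord.
  - destruct (H t HtX Ht) as [H'|H']; [left|auto].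
    apply (seq_ext t s n); auto; intros x Hx; symmetry; auto.
  - apply nat_ord, Ht.
Qed.

(** The shortlex minimum is a definable selector, so [choice_dichotomy] applies without a choice
    principle. *)
Lemma seq_dichotomy (S : M) : (forall s, s ∈ S -> fin_ord_seq s) ->
  card_le mu S \/ card_le S kappa.
Proof.
  intros HS.
  apply (choice_dichotomy S (fun X => iota (fun s => s ∈ X /\ forall t, t ∈ X -> t = s \/ lex s t))).
  { unfold lex; dfn. }
  intros X HX Hne; apply (iota_spec (fun s => s ∈ X /\ forall t, t ∈ X -> t = s \/ lex s t)).
  destruct (lex_min X) as (s & Hs & H); auto.
  exists s; split; [auto|]; intros t [Ht H'].
  destruct (H t Ht) as [E|E]; auto; destruct (H' s Hs) as [E'|E']; auto.
  now apply lex_asym in E'; auto.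
Qed.

Lemma regular_tree_bound : tree_bound mu kappa.
Proof.
  intros T [HT HT'] Hbr.
  set (L := fun n => sep T (fun s => ord_seq s n)).
  assert (DL : DFun L) by (unfold L; dfn).
  assert (HL : forall n s, s ∈ L n <-> s ∈ T /\ ord_seq s n).
  { intros n s; unfold L; rewrite in_sep by dfn; tauto. }
  assert (HLn : forall n, natural n -> ~ card_le mu (L n)).
  { apply nat_ind'; [dfn| |].
    (* Level [emp] holds at most the empty sequence, so an injection from [mu] would identify 0 and
       1. *)
    - intros H; apply card_le_map in H as (F & DF & Fm & Fi).
      assert (H0 : emp ∈ mu) by apply nat_in_mu, nat_emp.
      assert (H1 : suc emp ∈ mu) by now apply mu_suc.
      apply (in_emp emp).
      replace emp with (suc emp) at 2; [apply in_suc; auto|].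
      apply Fi; auto; apply (seq_ext _ _ emp).
      + apply HL, Fm, H1.
      + apply HL, Fm, H0.
      + intros x Hx; now apply in_emp in Hx.
    - intros n Hn IH H; apply card_le_map in H as (E & DE & Em & Ei).
      assert (Hseq : forall a, a ∈ mu -> ord_seq (E a) (suc n)).
      { intros a Ha; apply HL, Em, Ha. }
      (* Dropping the last value sends level [suc n] to level [n], which has size at most [kappa] by
         induction; unboundedly many sequences therefore share a restriction [s]. *)
      set (p := fun a => lam (fun x => ap (E a) x) n).
      assert (Dp : DFun p) by (unfold p; dfn).
      assert (Hin : forall x, x ∈ n -> x ∈ suc n) by (intros; apply in_suc; auto).
      assert (Hp : forall a, a ∈ mu -> ord_seq (p a) n).
      { intros a Ha; apply seq_lam; [assumption|dfn|].
        intros x Hx; apply (seq_ord _ (suc n)); auto. }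
      assert (Hpx : forall a x, x ∈ n -> ap (p a) x = ap (E a) x).
      { intros a x Hx; unfold p; rewrite ap_lam; [reflexivity|dfn|assumption]. }
      assert (HpL : forall a, a ∈ mu -> p a ∈ L n).
      { intros a Ha; apply HL; split; [|auto].
        apply (HT' (E a)); [now apply HL with (suc n), Em|exists n; auto|].
        intros z Hz; apply (seq_mem _ n) in Hz as (x & Hx & ->); auto.
        rewrite Hpx by assumption; apply (seq_mem _ (suc n)); auto; exists x; auto. }
      assert (HLk : card_le (L n) kappa).
      { destruct (seq_dichotomy (L n)) as [H|H]; auto; [|contradiction].
        intros s Hs; apply HL in Hs; apply HT, Hs. }
      destruct (pigeonhole (L n) p (fun _ => True) HLk Dp) as (s & Hs & HU);
        [dfn|apply mu_unbounded|auto|].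
      set (X := sep mu (fun a => p a = s)).
      assert (HX : forall a, a ∈ X <-> a ∈ mu /\ p a = s).
      { intros a; unfold X; rewrite in_sep by dfn; tauto. }
      apply HL in Hs as [HsT Hsn].
      destruct (Hbr s HsT) as (c & Hc & Hlt); apply reg_card_lt in Hlt.
      apply (mu_not_le kappa kappa_in), (card_le_trans _ c); [|assumption].
      apply (card_le_trans _ X).
      + apply equipotent_card_le, unbounded_equip; [intros a Ha; now apply HX|].
        intros b Hb; destruct (HU b Hb) as (a & Ha & [_ Ea] & Hba).
        exists a; rewrite HX; auto.
      (* Sequences of length [suc n] extending the same [s] are told apart by their last value. *)
      + apply card_le_map; exists (fun a => ap (E a) n); split; [dfn|split].
        * intros a Ha; apply HX in Ha as [Ha Ea]; apply Hc; split.
          -- apply (seq_ord _ (suc n)); auto; apply in_suc; auto.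
          -- exists (E a); split; [|now apply HL with (suc n), Em].
             apply seq_snoc; auto; intros x Hx; rewrite <- Ea; symmetry; auto.
        * intros a b Ha Hb Eab; apply HX in Ha as [Ha Ea], Hb as [Hb Eb].
          apply Ei; auto; apply (seq_ext _ _ (suc n)); auto.
          intros x Hx; apply in_suc in Hx as [Hx| ->]; [|assumption].
          rewrite <- (Hpx a), <- (Hpx b) by assumption; congruence. }
  destruct (seq_dichotomy T HT) as [H|H]; [exfalso|assumption].
  apply card_le_map in H as (E & DE & Em & Ei).
  (* There are only countably many lengths, so a copy of [mu] in [T] yields a copy in a single
     level. *)
  destruct (pigeonhole om (fun a => len (E a)) (fun _ => True)) as (n & Hn & HU);
    [apply card_le_subset, om_kappa|dfn|dfn|apply mu_unbounded| |].
  { intros a Ha _; destruct (HT (E a) (Em a Ha)) as [m Hm].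
    rewrite (len_eq _ m Hm); apply in_om, Hm. }
  apply in_om in Hn; apply (HLn n Hn).
  set (X := sep mu (fun a => len (E a) = n)).
  assert (HX : forall a, a ∈ X <-> a ∈ mu /\ len (E a) = n).
  { intros a; unfold X; rewrite in_sep by dfn; tauto. }
  apply (card_le_trans _ X).
  - apply equipotent_card_le, unbounded_equip; [intros a Ha; now apply HX|].
    intros b Hb; destruct (HU b Hb) as (a & Ha & [_ Ea] & Hba).
    exists a; rewrite HX; auto.
  - apply card_le_map; exists E; split; [assumption|split].
    + intros a Ha; apply HX in Ha as [Ha Ea]; apply HL; split; [auto|].
      destruct (HT (E a) (Em a Ha)) as [m Hm].
      rewrite (len_eq _ m Hm) in Ea; now subst.
    + intros a b Ha Hb; apply HX in Ha, Hb; apply Ei; tauto.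
Qed.

(** * Finite sequences in an ordinal, and pressing down *)

Lemma in_prod (a b z : M) : z ∈ prod a b <-> exists x y, x ∈ a /\ y ∈ b /\ z = opr x y.
Proof.
  unfold prod; rewrite in_Un; split.
  - intros (w & Hw & Hz); apply in_im in Hw as (x & Hx & ->); [|dfn].
    apply in_im in Hz as (y & Hy & ->); [|dfn]; eauto.
  - intros (x & y & Hx & Hy & ->); exists (im (fun y => opr x y) b).
    split; apply in_im; [dfn|eauto|dfn|eauto].
Qed.

Lemma fun_subset_prod (f n b : M) : natural n -> is_fun f n b -> f ⊆ prod om b.
Proof.
  intros Hn [H _] z Hz; destruct (H z Hz) as (x & y & Hx & Hy & Hp).
  apply opair_opr in Hp; apply in_prod; exists x, y; split; [|auto].
  apply in_om; now apply (nat_in n).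
Qed.

Lemma fun_ord_seq (f n b : M) : natural n -> ordinal b -> is_fun f n b -> ord_seq f n.
Proof.
  intros Hn Hb Hf; split; [assumption|]; exists b; split; [|assumption].
  intros a; now apply ord_in.
Qed.

Lemma sub_fun (s t n m b : M) : ordinal b -> natural n -> is_fun s n b -> ord_seq t m ->
  t ⊆ s -> is_fun t m b.
Proof.
  intros Hb Hn Hs Ht H; pose proof (fun_ord_seq s n b Hn Hb Hs) as Hs'.
  destruct (seq_sub s t n m Hs' Ht H) as [Hmn E].
  destruct Ht as (Hm & c & Hc & Hf); split; [|apply Hf].
  intros p Hp; pose proof Hf as [Hf1 _]; destruct (Hf1 p Hp) as (x & y & Hx & Hy & Hxy).
  exists x, y; split; [assumption|split; [|assumption]].
  apply opair_opr in Hxy; subst p; apply (fun_app s n b x y); [assumption|].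
  apply app_opr, H, Hp.
Qed.

(** A set of labels contained in some [b] below [mu] has size less than [mu], so exhibiting such a
    [b] replaces the cardinality condition on branching. *)
Lemma tree_bound_bounded (T : M) : tree_bound mu kappa -> tree T ->
  (forall s, s ∈ T -> exists b, b ∈ mu /\ forall a t, snoc s a t -> t ∈ T -> a ∈ b) ->
  card_le T kappa.
Proof.
  intros HTB HT H; apply HTB; [assumption|]; intros s Hs.
  destruct (H s Hs) as (b & Hb & Hb').
  exists (sep b (fun a => exists t, snoc s a t /\ t ∈ T)); split.
  - intros a; rewrite in_sep by dfn; split.
    + intros [Ha Ht]; split; [|assumption]; apply (ord_in b); auto using mu_in.
    + intros [Ha (t & Ht & HtT)]; split; eauto.
  - assert (Hsub : sep b (fun a => exists t, snoc s a t /\ t ∈ T) ⊆ b).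
    { intros a Ha; apply in_sep in Ha; [tauto|dfn]. }
    split.
    + apply card_le_subset, (subset_trans _ b); [assumption|].
      apply ord_sub; [apply mu_ord|assumption].
    + intros E; apply (mu_not_le kappa kappa_in).
      apply (card_le_trans _ _ _ (equipotent_card_le _ _ (equipotent_sym _ _ E))).
      now apply (bounded_le _ b).
Qed.

Lemma finite_le (x : M) : finite x -> card_le x kappa.
Proof.
  intros (n & Hn & H); apply (card_le_trans _ n).
  - now apply equipotent_card_le, equipotent_sym.
  - now apply in_mu_le, nat_in_mu.
Qed.

Definition seqs (b : M) : M :=
  sep (Pow (prod om b)) (fun s => exists n, natural n /\ is_fun s n b).

Lemma in_seqs (b s : M) : s ∈ seqs b <-> exists n, natural n /\ is_fun s n b.
Proof.
  unfold seqs; rewrite in_sep, in_Pow by dfn; split; [tauto|].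
  intros H; split; [|assumption]; destruct H as (n & Hn & H); now apply (fun_subset_prod s n).
Qed.

(** These sequences form a tree in which all labels lie below [b], so the bound on trees applies. *)
Lemma seqs_le (b : M) : b ∈ mu -> card_le (seqs b) kappa.
Proof.
  intros Hb; pose proof (mu_in b Hb) as Hbo.
  apply tree_bound_bounded; [apply regular_tree_bound|split|].
  - intros s Hs; apply in_seqs in Hs as (n & Hn & Hs).
    exists n; now apply (fun_ord_seq s n b).
  - intros s t Hs [m Ht] Hts; apply in_seqs in Hs as (n & Hn & Hs).
    apply in_seqs; exists m; split; [apply Ht|]; now apply (sub_fun s t n m b).
  - intros s Hs; exists b; split; [assumption|]; intros a t Hsn Ht.
    apply in_seqs in Hs as (n & Hn & Hs), Ht as (m & Hm & Ht).
    destruct (snoc_sub s a t n) as [_ H]; auto; [now apply (fun_ord_seq s n b)|].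
    now apply (fun_app t m b n a).
Qed.

(** If all fibres were bounded, a point [delta] closed under their suprema would
    lie in the fibre over the finite set [X delta], which is already contained
    in some [beta ∈ delta]. *)
Lemma finite_pressing_down (X : M -> M) : DFun X ->
  (forall a, a ∈ mu -> X a ⊆ a /\ finite (X a)) ->
  exists D, unbounded (fun a => X a = D).
Proof.
  intros DX HX; apply NNPP; intros Hno.
  assert (Hfib : forall D, ~ unbounded (fun a => X a = D)) by eauto.
  (* [h] will be the step of a closing-off argument: from [h b] on, no [X a] is contained in [b]. *)
  set (Q := fun b g => g ∈ mu /\ b ∈ g /\ forall a, a ∈ mu -> X a ⊆ b -> a ∈ g).
  assert (DQ : DRel Q) by (unfold Q; dfn).
  set (h := fun b => lst (fun g => Q b g)).
  assert (Dh : DFun h) by (unfold h; dfn).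
  assert (Sp : forall b, b ∈ mu -> Q b (h b)).
  { intros b Hb; assert (Hex : exists g, Q b g).
    (* A finite subset of [b] is the range of a sequence in [seqs b]. There are at most [kappa] such
       sequences, and each range is the value of [X] only on a bounded set. *)
    { assert (HU : ~ unbounded (fun a => exists s, s ∈ seqs b /\
        forall y, y ∈ X a <-> exists x, app s x y)).
      { apply (reg_union (seqs b) (fun s a => forall y, y ∈ X a <-> exists x, app s x y));
          [now apply seqs_le|dfn|].
        intros s _ HU; destruct (HU b Hb) as (a & _ & Ha & _).
        apply (Hfib (X a)); intros c Hc; destruct (HU c Hc) as (d & Hd & Hd' & Hcd).
        exists d; split; [assumption|split; [|assumption]].
        apply ext; intros y; now rewrite Hd', Ha. }
      apply not_unbounded in HU as (c & Hc & Hc').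
      assert (Hin : forall a, a ∈ mu -> X a ⊆ b -> a ∈ c).
      { intros a Ha Hab; apply Hc'; [assumption|].
        destruct (proj2 (HX a Ha)) as (n & Hn & f & (Hf & _) & Ho).
        exists f; split.
        - apply in_seqs; exists n; split; [assumption|]; destruct Hf as [Hf1 Hf2].
          split; [|assumption]; intros p Hp.
          destruct (Hf1 p Hp) as (x & y & Hx & Hy & Hxy); eauto 6.
        - intros y; split; [apply Ho|]; intros (x & Hx).
          now apply (fun_app f n (X a) x y). }
      destruct (ord_total b c) as [H|H]; auto using mu_in.
      - exists c; split; auto.
      - assert (Hcb : c ⊆ suc b).
        { apply (subset_trans _ b).
          - destruct H as [<-|H]; [apply subset_refl|]; apply ord_sub; auto using mu_in.
          - intros z Hz; apply in_suc; auto. }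
        exists (suc b); split; [now apply mu_suc|split; [apply in_suc; auto|]].
        intros a Ha Hab; now apply Hcb, Hin. }
    destruct Hex as (g & Hg); apply (lst_spec (Q b) g); [dfn|apply mu_in, Hg|assumption]. }
  (* Iterating [h] over [om] gives an increasing sequence whose supremum [delta] is below [mu] by
     regularity. *)
  set (F := rec (fun Z => h (Un Z))).
  assert (DF : DFun F) by (unfold F; dfn).
  assert (FE : forall n, n ∈ om -> F n = h (Un (im F n))).
  { intros n Hn; unfold F at 1; rewrite rec_eq; [reflexivity|dfn|].
    now apply nat_ord, in_om. }
  assert (Hsub : forall n m, n ∈ om -> m ∈ n -> m ∈ om).
  { intros n m Hn Hm; apply (ord_trans om m n); auto using ord_om. }
  assert (Fm : forall n, n ∈ om -> F n ∈ mu).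
  { intros n Hn; pose proof (ord_in _ _ ord_om Hn) as Hno'; revert n Hno' Hn.
    apply (ord_ind (fun n => n ∈ om -> F n ∈ mu)); [dfn|].
    intros n Hno' IH Hn; rewrite (FE n Hn); apply Sp.
    apply reg_Un; auto; [now apply nat_in_mu, in_om|]; intros m Hm; apply IH; eauto. }
  assert (Um : forall n, n ∈ om -> Un (im F n) ∈ mu).
  { intros n Hn; apply reg_Un; auto; [now apply nat_in_mu, in_om|].
    intros m Hm; apply Fm; eauto. }
  assert (Fi : incr_on F om).
  { intros m n Hm Hn Hmn.
    apply (ord_sub_in _ (Un (im F n))); auto using mu_in.
    - now apply Un_upper, in_im_intro.
    - rewrite (FE n Hn); now destruct (Sp _ (Um n Hn)) as (_ & H & _). }
  set (delta := Un (im F om)).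
  assert (Hd : delta ∈ mu).
  { apply reg_Un; auto; apply om_in_mu. }
  assert (Hlt : forall n, n ∈ om -> F n ⊆ delta).
  { intros n Hn; now apply Un_upper, in_im_intro. }
  destruct (HX delta Hd) as [HXd (n & Hn & HE)].
  apply equipotent_map in HE as (E & DE & Em & _ & Eo).
  (* The finite set [X delta] lies below one term of the sequence; its elements are added one by one
     along the enumeration [E]. *)
  assert (Key : forall k, natural k -> k ⊆ n -> exists m, m ∈ om /\ forall i, i ∈ k -> E i ∈ F m).
  { apply (nat_ind' (fun k => k ⊆ n -> exists m, m ∈ om /\ forall i, i ∈ k -> E i ∈ F m)); [dfn| |].
    - intros _; exists n; split; [now apply in_om|]; intros i Hi; now apply in_emp in Hi.
    - intros k Hk IH Hkn.
      assert (Hkin : k ∈ n) by (apply Hkn, in_suc; auto).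
      destruct IH as (m & Hm & H); [intros i Hi; apply Hkn, in_suc; auto|].
      pose proof (HXd _ (Em k Hkin)) as Hk'; apply in_Un in Hk' as (y & Hy & Hk').
      apply in_im in Hy as (m' & Hm' & ->); [|assumption].
      assert (HF : F m ⊆ F m' \/ F m' ⊆ F m).
      { destruct (ord_total m m') as [L|[L|L]]; [now apply nat_ord, in_om..| | |].
        - left; apply ord_sub; auto using mu_in.
        - subst; left; apply subset_refl.
        - right; apply ord_sub; auto using mu_in. }
      destruct HF as [HF|HF]; [exists m'|exists m]; split; auto;
        intros i Hi; apply in_suc in Hi as [Hi| ->]; auto. }
  destruct (Key n Hn (subset_refl n)) as (m & Hm & H).
  pose proof (om_suc m Hm) as Hsm.
  (* Now [X delta ⊆ F m], so the defining property of [h] at stage [suc m] puts [delta] below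
     [F (suc m)], which is itself at most [delta]. *)
  assert (Hdm : delta ∈ F (suc m)).
  { rewrite (FE _ Hsm); destruct (Sp _ (Um _ Hsm)) as (_ & _ & H'); apply H'; [assumption|].
    intros y Hy; apply Eo in Hy as (i & Hi & ->).
    apply in_Un; exists (F m); split; [|auto].
    apply in_im_intro; [assumption|apply in_suc; auto]. }
  apply (mem_irrefl delta), (Hlt (suc m)); assumption.
Qed.

(** * Finite sets and regressive functions *)

Lemma finite_emp : finite emp.
Proof. apply finite_nat, nat_emp. Qed.

Lemma equipotent_add (n D x : M) : equipotent n D -> x ∉ D ->
  equipotent (suc n) (cup D (upr x x)).
Proof.
  intros H Hx; apply equipotent_map in H as (F & DF & Fm & Fi & Fo).
  set (G := fun i => iota (fun y => i = n /\ y = x \/ i <> n /\ y = F i)).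
  assert (G1 : G n = x) by (apply iota_eq; [auto|]; intros z ?; tauto).
  assert (G2 : forall i, i ∈ n -> G i = F i).
  { intros i Hi; assert (Hne : i <> n) by (intros ->; now apply mem_irrefl in Hi).
    apply iota_eq; [auto|]; intros z ?; tauto. }
  apply equipotent_map; exists G; split; [unfold G; dfn|split; [|split]].
  - intros i Hi; apply in_cup; rewrite in_upr; apply in_suc in Hi as [Hi| ->].
    + rewrite G2; auto.
    + rewrite G1; auto.
  - intros i j Hi Hj E; apply in_suc in Hi as [Hi| ->], Hj as [Hj| ->]; auto.
    + rewrite !G2 in E by assumption; auto.
    + rewrite G1, G2 in E by assumption; exfalso; apply Hx; rewrite <- E; auto.
    + rewrite G1, G2 in E by assumption; exfalso; apply Hx; rewrite E; auto.
  - intros y Hy; apply in_cup in Hy as [Hy|Hy].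
    + destruct (Fo y Hy) as (i & Hi & ->); exists i; rewrite in_suc, G2; auto.
    + apply in_upr in Hy; exists n; rewrite in_suc, G1; split; [auto|tauto].
Qed.

Lemma finite_add (D x : M) : finite D -> finite (cup D (upr x x)).
Proof.
  intros (n & Hn & H); destruct (classic (x ∈ D)) as [Hx|Hx].
  - exists n; split; [assumption|]; replace (cup D (upr x x)) with D; [assumption|].
    apply ext; intros z; rewrite in_cup, in_upr; split; [auto|].
    intros [Hz|[-> | ->]]; assumption.
  - exists (suc n); split; [now apply nat_suc|now apply equipotent_add].
Qed.

Lemma finite_upr (x y : M) : finite (upr x y).
Proof.
  replace (upr x y) with (cup (cup emp (upr x x)) (upr y y)).
  - apply finite_add, finite_add, finite_emp.
  - apply ext; intros z; rewrite !in_cup, !in_upr; split; [|tauto].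
    intros [[H|H]|H]; [now apply in_emp in H|tauto|tauto].
Qed.

Lemma regular_Regressive : Regressive mu mu.
Proof.
  intros f [Hf Hreg'].
  (* Cutting with [a] makes [X a] the singleton of [ap f a] for nonzero [a], and empty for
     [a = emp], where [f] cannot decrease. *)
  set (X := fun a => sep a (fun y => y = ap f a)).
  assert (DX : DFun X) by (unfold X; dfn).
  assert (HX : forall a y, y ∈ X a <-> y ∈ a /\ y = ap f a).
  { intros a y; unfold X; rewrite in_sep by dfn; tauto. }
  assert (Hap : forall a, a ∈ mu -> a <> emp -> ap f a ∈ a).
  { intros a Ha Hne; apply Hreg'; [assumption|now rewrite empty_emp|].
    apply (fun_ap f mu mu); auto. }
  destruct (finite_pressing_down X DX) as (D & HD).
  { intros a Ha; split; [intros y Hy; now apply HX in Hy|].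
    destruct (classic (a = emp)) as [E|E].
    - replace (X a) with (emp : M); [apply finite_emp|].
      apply ext; intros y; rewrite HX, E; split; [intros Hy; now apply in_emp in Hy|].
      intros [Hy _]; exact Hy.
    - replace (X a) with (upr (ap f a) (ap f a)); [apply finite_upr|].
      apply ext; intros y; rewrite HX, in_upr; split; [|tauto].
      intros [-> | ->]; auto. }
  (* The threshold 1 makes [a0] nonzero, so the common value [D] is a singleton and fixes the value
     of [f] on the fibre. *)
  destruct (HD (suc emp)) as (a0 & Ha0 & E0 & Hle); [apply nat_in_mu, nat_suc, nat_emp|].
  assert (Hne : a0 <> emp).
  { intros ->; apply (in_emp emp), Hle, in_suc; auto. }
  assert (H0 : ap f a0 ∈ D) by (rewrite <- E0; apply HX; auto).
  exists (ap f a0); split; [now apply (ap_in f mu mu)|].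
  set (Y := sep mu (fun x => ap f x = ap f a0)).
  assert (HY : forall x, x ∈ Y <-> x ∈ mu /\ ap f x = ap f a0).
  { intros x; unfold Y; rewrite in_sep by dfn; tauto. }
  exists Y; split.
  - intros x; rewrite HY, (fun_ap f mu mu) by assumption; intuition.
  - apply equipotent_card_le, unbounded_equip; [intros x Hx; now apply HY|].
    intros b Hb; destruct (HD b Hb) as (a & Ha & Ea & Hba).
    exists a; rewrite HY; split; [assumption|split; [split; [assumption|]|assumption]].
    rewrite <- Ea in H0; apply HX in H0; symmetry; tauto.
Qed.

(** * The partition relation for regular successors *)

Lemma order_type_intro (F : M -> M) (a H : M) : ordinal a -> (forall h, h ∈ H -> ordinal h) ->
  DFun F -> maps F a H -> onto F a H -> incr_on F a -> order_type H a.
Proof.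
  intros Ha HH DF Fm Fo Fi; split; [assumption|]; exists (lam F a); split.
  - apply bijection_lam; auto using incr_inj.
  - intros x y u v Hx Hy; apply app_lam in Hx as [Hx ->], Hy as [Hy ->]; auto.
    split; [apply Fi; assumption|]; intros Huv.
    destruct (ord_total x y) as [L|[L|L]]; auto; try now apply (ord_in a).
    + subst; now apply mem_irrefl in Huv.
    + apply Fi in L; auto; apply ord_asym in L; [contradiction|auto].
Qed.

Lemma regular_partition : partition_arrow_omega_plus_one mu mu.
Proof.
  exists om, (suc om); split; [apply om_omega|split; [now apply succ_suc|]].
  intros zero one two P f H0 H1 H2 HP Hf.
  apply empty_emp in H0; apply succ_suc in H1, H2.
  set (col := fun a b => ap f (upr a b)).
  assert (Dcol : DTrm (fun e => col (e 0) (e 1))) by (unfold col; dfn).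
  assert (Hsym : forall a b, upr a b = upr b a).
  { intros a b; apply ext; intros z; rewrite !in_upr; tauto. }
  assert (HinP : forall a b, a ∈ mu -> b ∈ mu -> a <> b -> upr a b ∈ P).
  { intros a b Ha Hb Hab; apply HP; exists a, b; rewrite upair_upr; auto. }
  assert (Hcol : forall a b i, a ∈ mu -> b ∈ mu -> a <> b -> app f (upr a b) i <-> i = col a b).
  { intros a b i Ha Hb Hab; rewrite (fun_ap f P two) by assumption; unfold col.
    split; [tauto|auto]. }
  assert (Hcol2 : forall a b, a ∈ mu -> b ∈ mu -> a <> b -> col a b = zero \/ col a b = one).
  { intros a b Ha Hb Hab; pose proof (ap_in f P two _ Hf (HinP a b Ha Hb Hab)) as H.
    fold (col a b) in H; subst two one zero.
    apply in_suc in H as [H|H]; [|auto]; apply in_suc in H as [H|H]; [|auto].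
    now apply in_emp in H. }
  assert (Hne : forall a b : M, a ∈ b -> a <> b).
  { intros a b H ->; now apply mem_irrefl in H. }
  assert (Hconst : forall H i : M, H ⊆ mu -> (forall a b, a ∈ H -> b ∈ H -> a ∈ b -> col a b = i) ->
            constant_on_pairs f H i).
  { intros H i HH Hi a b x Ha Hb Hab Hx; apply upair_upr in Hx; subst x.
    destruct (ord_total a b) as [L|[L|L]]; auto using mu_in.
    - apply Hcol; auto; symmetry; auto.
    - contradiction.
    - rewrite Hsym; apply Hcol; auto; symmetry; auto. }
  (* Eligibility of [b] as the next member, after [Z], of the greedy colour-1 set below [a]. [G a n]
     is the choice at step [n], meaningful only while candidates exist. *)
  set (ok := fun a Z b : M => b ∈ a /\ col b a = one /\ forall c, c ∈ Z -> c ∈ b /\ col c b = one).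
  set (G := fun a => rec (fun Z => lst (fun b => ok a Z b))).
  assert (DG : DTrm (fun e => G (e 0) (e 1))) by (unfold G, ok; dfn).
  assert (DG' : forall a, DFun (G a)) by (intros a; unfold G, ok; dfn).
  assert (GE : forall a n, ordinal n -> G a n = lst (fun b => ok a (im (G a) n) b)).
  { intros a n Hn; unfold G at 1; rewrite rec_eq; [reflexivity|unfold ok; dfn|assumption]. }
  assert (Gok : forall a n, a ∈ mu -> ordinal n -> (exists b, ok a (im (G a) n) b) ->
            ok a (im (G a) n) (G a n)).
  { intros a n Ha Hn [b Hb]; rewrite (GE a n Hn).
    apply (lst_spec (fun b => ok a (im (G a) n) b) b); [unfold ok; dfn| |assumption].
    apply (ord_in a); [now apply mu_in|apply Hb]. }
  destruct (classic (exists a, a ∈ mu /\ forall n, n ∈ om -> exists b, ok a (im (G a) n) b))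
    as [(a & Ha & Hall)|Hstop].
  - right; pose proof (mu_in a Ha) as Hao.
    assert (Hok : forall n, n ∈ om -> ok a (im (G a) n) (G a n)).
    { intros n Hn; apply Gok; auto; now apply nat_ord, in_om. }
    (* The greedy choices fill the first [om] places, and [a] itself is put on top. *)
    set (F := fun x => iota (fun y => x = om /\ y = a \/ x <> om /\ y = G a x)).
    assert (DF : DFun F) by (unfold F; dfn).
    assert (F1 : F om = a) by (apply iota_eq; [auto|]; intros z ?; tauto).
    assert (F2 : forall n, n ∈ om -> F n = G a n).
    { intros n Hn; pose proof (Hne n om Hn); apply iota_eq; [auto|]; intros z ?; tauto. }
    assert (Hlt : forall x y, y ∈ suc om -> x ∈ y -> F x ∈ F y /\ col (F x) (F y) = one).
    { intros x y Hy Hx; apply in_suc in Hy as [Hy| ->].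
      - assert (Hxo : x ∈ om) by (apply (ord_trans om x y); auto using ord_om).
        rewrite !F2 by assumption; apply (Hok y Hy); now apply in_im_intro.
      - rewrite F1, F2 by assumption; split; apply (Hok x Hx). }
    assert (HFm : forall x, x ∈ suc om -> F x ∈ mu).
    { intros x Hx; apply in_suc in Hx as [Hx| ->]; [|now rewrite F1].
      rewrite F2 by assumption; apply (ord_trans mu _ a mu_ord); [|assumption]; now apply Hok. }
    pose proof (ord_suc om ord_om) as Hso.
    exists (im F (suc om)); split; [|split].
    + intros y Hy; apply in_im in Hy as (x & Hx & ->); auto.
    + apply (order_type_intro F); auto.
      * intros h Hh; apply in_im in Hh as (x & Hx & ->); auto using mu_in.
      * intros x Hx; now apply in_im_intro.
      * intros y Hy; now apply in_im in Hy.
      * intros x y Hx Hy Hxy; now apply Hlt.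
    + apply Hconst; [intros y Hy; apply in_im in Hy as (x & Hx & ->); auto|].
      intros u v Hu Hv Huv; apply in_im in Hu as (x & Hx & ->), Hv as (y & Hy & ->); auto.
      apply Hlt; [assumption|].
      destruct (ord_total x y) as [L|[L|L]]; auto; try (now apply (ord_in (suc om))).
      * rewrite L in Huv; now apply mem_irrefl in Huv.
      * apply Hlt in L as [L _]; auto; apply ord_asym in L; [contradiction|auto using mu_in].
  - left.
    assert (Hst : forall a, a ∈ mu -> exists n, n ∈ om /\ ~ exists b, ok a (im (G a) n) b).
    { intros a Ha; apply NNPP; intros H; apply Hstop; exists a; split; [assumption|].
      intros n Hn; apply NNPP; eauto. }
    (* [N a] is the step at which the greedy choice stops, so the chosen set [X a] is a finite
       subset of [a]. *)
    set (N := fun a => lst (fun n => n ∈ om /\ ~ exists b, ok a (im (fun x => G a x) n) b)).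
    assert (DN : DFun N) by (unfold N, ok; dfn).
    assert (HN : forall a, a ∈ mu -> N a ∈ om /\ (~ exists b, ok a (im (G a) (N a)) b) /\
              forall n, n ∈ N a -> ok a (im (G a) n) (G a n)).
    { intros a Ha; destruct (Hst a Ha) as (n & Hn & Hnb).
      destruct (lst_spec (fun n => n ∈ om /\ ~ exists b, ok a (im (fun x => G a x) n) b) n)
        as (Ho & [Q1 Q2] & _ & Q3); [unfold ok; dfn|now apply nat_ord, in_om|auto|].
      split; [assumption|split; [assumption|]].
      intros k Hk; apply Gok; [assumption|now apply (ord_in (N a))|].
      apply NNPP; intros Hnk; apply (Q3 k Hk); split; [|assumption].
      apply (ord_trans om k (N a)); auto using ord_om. }
    set (X := fun a => im (fun x => G a x) (N a)).
    assert (DX : DFun X) by (unfold X; dfn).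
    assert (HX : forall a y, y ∈ X a <-> exists n, n ∈ N a /\ y = G a n).
    { intros a y; unfold X; now rewrite in_im by dfn. }
    destruct (finite_pressing_down X DX) as (D & HD).
    { intros a Ha; destruct (HN a Ha) as (N1 & N2 & N3); split.
      - intros y Hy; apply HX in Hy as (n & Hn & ->); now apply N3.
      - exists (N a); split; [now apply in_om|].
        apply equipotent_im; [dfn|]; apply incr_inj; [now apply nat_ord, in_om|].
        intros x y Hx Hy Hxy; apply (N3 y Hy); now apply in_im_intro. }
    set (H := sep mu (fun a => X a = D)).
    assert (HH : forall a, a ∈ H <-> a ∈ mu /\ X a = D).
    { intros a; unfold H; rewrite in_sep by dfn; tauto. }
    assert (HHm : H ⊆ mu) by (intros a Ha; now apply HH).
    exists H; split; [assumption|split].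
    + destruct (unbounded_enum H HHm) as (F & DF & Fm & Fo & Fi).
      { intros b Hb; destruct (HD b Hb) as (a & Ha & Ea & Hba).
        exists a; rewrite HH; auto. }
      apply (order_type_intro F); auto using mu_ord, mu_in.
    + apply Hconst; [assumption|]; intros a b Ha Hb Hab.
      apply HH in Ha as [Ha Ea], Hb as [Hb Eb].
      (* If the pair had colour 1, [a] would be eligible after all of [X b], because [X b = D = X a]
         lies below [a] and has colour 1 with [a]. The choice for [b] would then not have
         stopped. *)
      destruct (Hcol2 a b) as [?|Hone]; auto; exfalso.
      destruct (HN a Ha) as (_ & _ & N3), (HN b Hb) as (_ & N2 & _).
      apply N2; exists a; split; [assumption|split; [assumption|]].
      intros c Hc; assert (Hc' : c ∈ X a) by (rewrite Ea, <- Eb; exact Hc).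
      apply HX in Hc' as (n & Hn & ->); destruct (N3 n Hn) as (? & ? & _); auto.
Qed.

(** * Delta-systems for regular successors *)

Lemma mu_max (a b : M) : a ∈ mu -> b ∈ mu -> exists c, c ∈ mu /\ a ⊆ c /\ b ⊆ c.
Proof.
  intros Ha Hb; destruct (ord_total a b) as [H|[H|H]]; auto using mu_in.
  - exists b; split; [assumption|split; [apply ord_sub; auto using mu_in|apply subset_refl]].
  - subst; exists b; auto using subset_refl.
  - exists a; split; [assumption|split; [apply subset_refl|apply ord_sub; auto using mu_in]].
Qed.

Lemma regular_delta : delta_arrow mu mu.
Proof.
  intros A HA HE; apply equipotent_sym, equipotent_map in HE as (E & DE & Em & Ei & Eo).
  set (sz := fun a => lst (fun n => natural n /\ equipotent n (E a))).
  assert (Dsz : DFun sz) by (unfold sz; dfn).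
  assert (Hsz : forall a, a ∈ mu -> natural (sz a) /\ equipotent (sz a) (E a)).
  { intros a Ha; destruct (HA (E a) (Em a Ha)) as [(n & Hn & H) _].
    apply (lst_spec (fun n => natural n /\ equipotent n (E a)) n); [dfn|now apply nat_ord|auto]. }
  destruct (pigeonhole om sz (fun _ => True)) as (n & Hn & HU);
    [apply card_le_subset, om_kappa|assumption|dfn|apply mu_unbounded| |].
  { intros a Ha _; apply in_om; now apply Hsz. }
  apply in_om in Hn.
  set (K := fun D a => sz a = n /\ D ⊆ E a).
  assert (DK : DRel K) by (unfold K; dfn).
  (* Sizes of candidate kernels. They are bounded by the common size [n] of the sets, so some good
     [m] has [suc m] not good. *)
  set (good := fun m => exists D, equipotent m D /\ unbounded (fun a => K D a)).
  assert (Hgood : forall m, natural m -> good m -> m ⊆ n).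
  { intros m Hm (D & HD & HU').
    destruct (HU' emp) as (a & Ha & [Ean HDa] & _); [apply nat_in_mu, nat_emp|].
    apply nat_card_le; auto.
    apply (card_le_trans _ D); [now apply equipotent_card_le|].
    apply (card_le_trans _ (E a)); [now apply card_le_subset|].
    rewrite <- Ean; now apply equipotent_card_le, equipotent_sym, Hsz. }
  assert (Hmax : exists m, natural m /\ good m /\ ~ good (suc m)).
  { apply NNPP; intros Hno.
    assert (Hall : forall m, natural m -> good m).
    { apply nat_ind'.
      - unfold good, unbounded; dfn.
      - exists emp; split; [apply equipotent_refl|].
        intros b Hb; destruct (HU b Hb) as (a & Ha & [_ Ea] & Hba).
        exists a; repeat split; auto using emp_sub.
      - intros m Hm IH; apply NNPP; intros Hg; apply Hno; eauto. }
    apply (mem_irrefl n), (Hgood (suc n)); [now apply nat_suc|now apply Hall, nat_suc|].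
    apply in_suc; auto. }
  destruct Hmax as (m & Hm & (D & HmD & HKD) & Hng).
  (* Otherwise [D] with [x] added would be a candidate of size [suc m]. *)
  assert (Hx : forall x, x ∉ D -> ~ unbounded (fun a => K D a /\ x ∈ E a)).
  { intros x HxD HU'; apply Hng; exists (cup D (upr x x)); split; [now apply equipotent_add|].
    intros b Hb; destruct (HU' b Hb) as (a & Ha & [[Ea HDa] Hxa] & Hba).
    exists a; split; [assumption|split; [split; [assumption|]|assumption]].
    intros y Hy; apply in_cup in Hy as [Hy|Hy]; [auto|].
    apply in_upr in Hy; assert (y = x) as -> by tauto; assumption. }
  (* [F] repeatedly takes the least index beyond the earlier ones whose set contains [D] and meets
     the earlier sets only inside [D]. *)
  set (Phi := fun Z a => (a ∈ mu /\ K D a) /\ forall b, b ∈ Z -> b ∈ a /\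
    forall x, x ∈ E b -> x ∈ E a -> x ∈ D).
  assert (DPhi : DRel Phi) by (unfold Phi; dfn).
  set (F := rec (fun Z => lst (fun a => Phi Z a))).
  assert (DF : DFun F) by (unfold F; dfn).
  assert (FE : forall a, ordinal a -> F a = lst (fun b => Phi (im F a) b)).
  { intros a Ha; unfold F at 1; rewrite rec_eq; [reflexivity|dfn|assumption]. }
  assert (HF : forall a, a ∈ mu -> Phi (im F a) (F a)).
  { intros a Ha; pose proof (mu_in a Ha) as Hao; revert a Hao Ha.
    apply (ord_ind (fun a => a ∈ mu -> Phi (im F a) (F a))); [dfn|].
    intros a Hao IH Ha.
    assert (Hin : forall b, b ∈ a -> b ∈ mu) by (intros b Hb; apply (ord_trans mu b a); auto using mu_ord).
    assert (Fm : maps F a mu).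
    { intros b Hb; now apply (IH b Hb (Hin b Hb)). }
    destruct (Hreg a F Ha DF Fm) as (b0 & Hb0 & Hlt).
    (* The sets chosen so far are finite and at most [kappa] many. Each of their points outside [D]
       excludes a bounded set of indices, so two uses of [reg_union] bound all excluded indices. *)
    assert (HB : ~ unbounded (fun c => exists b, b ∈ a /\
       exists x, x ∈ E (F b) /\ (x ∉ D /\ K D c /\ x ∈ E c))).
    { apply (reg_union a (fun b c => exists x, x ∈ E (F b) /\ (x ∉ D /\ K D c /\ x ∈ E c)));
        [now apply in_mu_le|dfn|].
      intros b Hb; apply (reg_union (E (F b)) (fun x c => x ∉ D /\ K D c /\ x ∈ E c)).
      - apply finite_le; now apply HA, Em, Fm.
      - dfn.
      - intros x _ HU'; destruct (classic (x ∈ D)) as [HxD|HxD].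
        + destruct (HU' b0 Hb0) as (c & _ & [H _] & _); contradiction.
        + apply (Hx x HxD); intros c Hc; destruct (HU' c Hc) as (c' & H1 & [_ H2] & H3); eauto. }
    apply not_unbounded in HB as (b1 & Hb1 & HB).
    destruct (mu_max b0 b1 Hb0 Hb1) as (b & Hb & Hb0b & Hb1b).
    destruct (HKD b Hb) as (c & Hc & HKc & Hbc).
    rewrite (FE a Hao).
    apply (lst_spec (fun b => Phi (im F a) b) c); [dfn|now apply mu_in|].
    split; [auto|]; intros z Hz; apply in_im in Hz as (i & Hi & ->); [|assumption].
    split; [apply Hbc, Hb0b; auto|]; intros x Hxi Hxc; apply NNPP; intros HxD.
    apply (mem_irrefl c), Hbc, Hb1b, HB; [assumption|].
    exists i; split; [assumption|]; exists x; auto. }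
  assert (HKF : forall a, a ∈ mu -> F a ∈ mu /\ D ⊆ E (F a)).
  { intros a Ha; destruct (HF a Ha) as [[? [_ ?]] _]; auto. }
  assert (HD : forall a b, a ∈ mu -> b ∈ mu -> a ∈ b -> F a ∈ F b /\
    forall x, x ∈ E (F a) -> x ∈ E (F b) -> x ∈ D).
  { intros a b Ha Hb Hab; apply (HF b Hb); now apply in_im_intro. }
  set (EF := fun a => E (F a)).
  assert (DEF : DFun EF) by (unfold EF; dfn).
  exists (im EF mu); split; [|split].
  - intros X HX; apply in_im in HX as (a & Ha & ->); [|assumption]; apply Em, HKF, Ha.
  - exists D; intros X Y HX HY HXY z.
    apply in_im in HX as (a & Ha & ->); [|assumption].
    apply in_im in HY as (b & Hb & ->); [|assumption].
    split.
    + intros Hz; split; apply HKF; assumption.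
    + intros [H1 H2]; destruct (ord_total a b) as [L|[L|L]]; auto using mu_in.
      * destruct (HD a b Ha Hb L) as [_ H]; apply H; assumption.
      * subst b; contradiction.
      * destruct (HD b a Hb Ha L) as [_ H]; apply H; assumption.
  - apply equipotent_sym, equipotent_im; [assumption|].
    intros a b Ha Hb Eab; apply Ei in Eab; [|now apply HKF..].
    revert Eab; apply (incr_inj F mu); auto using mu_ord.
    intros x y Hx' Hy Hxy; now apply HD.
Qed.
End Regular.

(** * From the combinatorial properties back to regularity *)

Lemma tree_bound_is_cf : tree_bound mu kappa -> is_cf mu mu.
Proof.
  intros HTB; apply NNPP; intros Hn; destruct (singular Hn) as (d & Hd & Hc).
  destruct (cofinal_index d (mu_in d Hd) Hc) as (F & I & DF & DI & Fm & Im & HFI & _).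
  set (one := suc emp); set (two := suc one).
  assert (N1 : natural one) by apply nat_suc, nat_emp.
  assert (N2 : natural two) by now apply nat_suc.
  assert (Hne : one <> emp).
  { intros E; apply (in_emp emp); rewrite <- E at 2; apply in_suc; auto. }
  assert (E1 : emp ∈ one) by (apply in_suc; auto).
  (* The tree has sequences of length at most 2, with first entry below [d] and second entry at most
     [F] of the first. All branching is bounded below [mu], yet every pair [(I a, a)] occurs. *)
  set (ok := fun s n => (emp ∈ n -> ap s emp ∈ d) /\ (one ∈ n -> ap s one ∈ suc (F (ap s emp)))).
  assert (Dok : DRel ok) by (unfold ok; dfn).
  set (T := sep (Pow (prod om mu)) (fun s => exists n, n ∈ suc two /\ is_fun s n mu /\ ok s n)).
  assert (HT : forall s, s ∈ T <-> exists n, n ∈ suc two /\ is_fun s n mu /\ ok s n).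
  { intros s; unfold T; rewrite in_sep, in_Pow by dfn; split; [tauto|].
    intros H; split; [|assumption]; destruct H as (n & Hn' & Hs & _).
    apply (fun_subset_prod s n); [|assumption].
    now apply (nat_in (suc two)); [apply nat_suc|]. }
  assert (Hnat : forall n, n ∈ suc two -> natural n).
  { intros n; now apply nat_in, nat_suc. }
  assert (HTk : card_le T kappa).
  { apply tree_bound_bounded; [assumption|split|].
    - intros s Hs; apply HT in Hs as (n & Hn' & Hs & _).
      exists n; apply (fun_ord_seq s n mu); auto using mu_ord.
    - intros s t Hs [m Ht] Hts; apply HT in Hs as (n & Hn' & Hs & H1 & H2).
      pose proof (fun_ord_seq s n mu (Hnat n Hn') mu_ord Hs) as Hs'.
      destruct (seq_sub s t n m Hs' Ht Hts) as [Hmn E].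
      pose proof (nat_ord m (proj1 Ht)) as Hmo.
      apply HT; exists m; split; [|split; [|split]].
      + apply (ord_sub_in m n); auto using nat_ord, ord_suc.
      + apply (sub_fun s t n m mu); auto using mu_ord.
      + intros H; rewrite E by assumption; auto.
      + intros H; rewrite !E; auto; now apply (ord_trans m emp one).
    - intros s Hs; apply HT in Hs as (n & Hn' & Hs & Hoks).
      pose proof (fun_ord_seq s n mu (Hnat n Hn') mu_ord Hs) as Hs'.
      assert (Hcase : forall a t, snoc s a t -> t ∈ T -> n = emp /\ a ∈ d \/
        n = one /\ a ∈ suc (F (ap s emp))).
      { intros a t Ha Ht; apply HT in Ht as (m & Hm & Ht & H1 & H2).
        destruct (snoc_sub s a t n Hs' Ha) as [Hst Hta].
        apply (fun_ap t m mu) in Hta as [Hnm ->]; [|assumption].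
        assert (Hn2 : n ∈ two).
        { apply in_suc in Hm as [Hm| ->]; [|assumption].
          apply (ord_trans two n m); auto using nat_ord. }
        apply in_suc in Hn2 as [Hn2| ->].
        - left; apply in_suc in Hn2 as [Hn2| ->]; [now apply in_emp in Hn2|auto].
        - right; split; [reflexivity|].
          pose proof (fun_ord_seq t m mu (Hnat m Hm) mu_ord Ht) as Ht'.
          destruct (seq_sub t s m one Ht' Hs' Hst) as [_ E].
          rewrite E by assumption; auto. }
      destruct (classic (n = emp)) as [->|Hn0].
      + exists d; split; [assumption|]; intros a t Ha Ht.
        destruct (Hcase a t Ha Ht) as [[_ H]|[H _]]; [assumption|]; now symmetry in H.
      + destruct (classic (n = one)) as [->|Hn1].
        * exists (suc (F (ap s emp))); split; [apply mu_suc, Fm; now apply Hoks|].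
          intros a t Ha Ht; destruct (Hcase a t Ha Ht) as [[H _]|[_ H]]; tauto.
        (* Sequences of length 2 have no extensions in [T], so any bound will do. *)
        * exists kappa; split; [apply kappa_in|].
          intros a t Ha Ht; destruct (Hcase a t Ha Ht) as [[H _]|[H _]]; tauto. }
  apply (mu_not_le kappa kappa_in), (card_le_trans _ T); [|assumption].
  set (v := fun a x => iota (fun y => x = emp /\ y = I a \/ x <> emp /\ y = a)).
  assert (Dv : DTrm (fun e => v (e 0) (e 1))) by (unfold v; dfn).
  assert (v0 : forall a, v a emp = I a) by (intros a; apply iota_eq; [auto|]; intros z ?; tauto).
  assert (v1 : forall a, v a one = a) by (intros a; apply iota_eq; [auto|]; intros z ?; tauto).
  assert (E02 : emp ∈ two) by (apply in_suc; auto).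
  assert (E12 : one ∈ two) by (apply in_suc; auto).
  assert (Hap : forall a x, x ∈ two -> ap (lam (fun x => v a x) two) x = v a x).
  { intros a x Hx; rewrite ap_lam; [reflexivity|dfn|assumption]. }
  apply card_le_map; exists (fun a => lam (fun x => v a x) two); split; [dfn|split].
  - intros a Ha; apply HT; exists two; split; [apply in_suc; auto|split; [|split]].
    + apply fun_lam; [dfn|]; intros x Hx; apply in_suc in Hx as [Hx| ->]; [|now rewrite v1].
      apply in_suc in Hx as [Hx| ->]; [now apply in_emp in Hx|]; rewrite v0.
      apply (ord_trans mu _ d mu_ord); auto.
    + intros _; rewrite Hap, v0 by assumption; auto.
    + intros _; rewrite !Hap, v0, v1 by assumption.
      apply in_suc_sub; auto using mu_in.
  - intros a b Ha Hb E; rewrite <- (v1 a), <- (v1 b), <- !Hap by assumption.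
    now rewrite E.
Qed.

Lemma Regressive_is_cf : Regressive mu mu -> is_cf mu mu.
Proof.
  intros HR; apply NNPP; intros Hn; destruct (singular Hn) as (d & Hd & Hc).
  destruct (cofinal_index d (mu_in d Hd) Hc) as (F & I & DF & DI & Fm & Im & HFI & _).
  (* Every index is below [d], so [I] is regressive from [d] on; below [d] the value [emp] is used
     instead. *)
  set (G := fun a => iota (fun y => a ∈ d /\ y = emp \/ a ∉ d /\ y = I a)).
  assert (DG : DFun G) by (unfold G; dfn).
  assert (G1 : forall a, a ∈ d -> G a = emp).
  { intros a Ha; apply iota_eq; [auto|]; intros z ?; tauto. }
  assert (G2 : forall a, a ∉ d -> G a = I a).
  { intros a Ha; apply iota_eq; [auto|]; intros z ?; tauto. }
  assert (Hdm : forall a, a ∈ d -> a ∈ mu).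
  { intros a Ha; apply (ord_trans mu a d mu_ord); assumption. }
  destruct (HR (lam G mu)) as (a & Ha & Y & HY & HYc).
  { split.
    - apply fun_lam; [assumption|]; intros a Ha; destruct (classic (a ∈ d)) as [H|H].
      + rewrite G1 by assumption; apply nat_in_mu, nat_emp.
      + rewrite G2 by assumption; auto.
    - intros a y Ha Hne Hy; apply app_lam in Hy as [_ ->]; [|assumption].
      destruct (classic (a ∈ d)) as [H|H].
      + rewrite G1 by assumption; apply emp_in; [now apply mu_in|].
        intros E; now apply Hne, empty_emp.
      + rewrite G2 by assumption; apply ord_notin in H; auto using mu_in. }
  (* The fibre consists of points below [d] and, when its value [a] is below [d], of points at most
     [F a]; both parts are bounded. *)
  assert (HYb : forall x, x ∈ Y -> x ∈ d \/ a ∈ d /\ x ∈ suc (F a)).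
  { intros x Hx; apply HY, app_lam in Hx as [Hx ->]; [|assumption].
    destruct (classic (x ∈ d)) as [H|H]; [auto|right].
    rewrite G2 by assumption; split; [auto|]; apply in_suc_sub; auto using mu_in. }
  apply (mu_not_le kappa kappa_in), (card_le_trans _ Y); [assumption|].
  destruct (classic (a ∈ d)) as [Had|Had].
  - destruct (mu_max d (suc (F a))) as (b & Hb & H1 & H2); [assumption|apply mu_suc; auto|].
    apply (bounded_le _ b); [assumption|]; intros x Hx.
    destruct (HYb x Hx) as [H|[_ H]]; auto.
  - apply (bounded_le _ d); [assumption|]; intros x Hx.
    destruct (HYb x Hx) as [H|[H _]]; tauto.
Qed.

(** [shift d a] is the ordinal sum [d + a]. *)
Definition shift (d : M) : M -> M := rec (fun Z => cup d Z).

Lemma DFun_shift (d : M) : DFun (shift d).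
Proof. unfold shift; dfn. Qed.

Lemma shift_mem (d a z : M) : ordinal a ->
  z ∈ shift d a <-> z ∈ d \/ exists b, b ∈ a /\ z = shift d b.
Proof.
  intros Ha; pose proof (DFun_shift d); unfold shift at 1.
  rewrite rec_eq by (dfn || assumption); fold (shift d).
  now rewrite in_cup, in_im by assumption.
Qed.

Lemma shift_ord (d a : M) : ordinal d -> ordinal a -> ordinal (shift d a).
Proof.
  intros Hd; pose proof (DFun_shift d); revert a.
  apply (ord_ind (fun a => ordinal (shift d a))); [dfn|].
  intros a Ha IH; apply ord_intro.
  - intros x Hx z Hz; apply shift_mem in Hx as [Hx|(b & Hb & ->)]; auto;
      apply shift_mem; auto.
    + left; now apply (ord_trans d z x).
    + apply shift_mem in Hz as [Hz|(c & Hc & ->)]; [auto| |now apply (ord_in a)].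
      right; exists c; split; [now apply (ord_trans a c b)|reflexivity].
  - intros x Hx; apply shift_mem in Hx as [Hx|(b & Hb & ->)]; auto; now apply (ord_in d).
Qed.

Lemma delta_is_cf : delta_arrow mu mu -> is_cf mu mu.
Proof.
  intros HDel; apply NNPP; intros Hn; destruct (singular Hn) as (d & Hd & Hc).
  pose proof (mu_in d Hd) as Hdo.
  destruct (cofinal_index d Hdo Hc) as (F & I & DF & DI & Fm & Im & HFI & _).
  pose proof (DFun_shift d) as DS.
  (* Adding [d] pushes the second element out of the range of indices, so the two elements of [g a]
     cannot be confused and [g] is injective. *)
  set (g := fun a => upr (I a) (shift d a)).
  assert (Dg : DFun g) by (unfold g; dfn).
  assert (Hsd : forall a, ordinal a -> shift d a ∉ d).
  { intros a Ha H; apply (mem_irrefl (shift d a)), shift_mem; auto. }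
  assert (Sinc : incr_on (shift d) mu).
  { intros a b Ha Hb Hab; apply shift_mem; [now apply mu_in|]; eauto. }
  assert (gi : inj_on g mu).
  { intros a b Ha Hb E; apply upr_inj in E as [[_ E]|[_ E]].
    - revert E; apply (incr_inj (shift d) mu); auto using mu_ord.
    - exfalso; apply (Hsd a); [now apply mu_in|]; rewrite E; auto. }
  destruct (HDel (im g mu)) as (B & HB & (D & HBD) & HBm).
  { intros X HX; apply in_im in HX as (a & Ha & ->); [|assumption].
    split; [apply finite_upr|]; intros x Hx; apply in_upr in Hx as [-> | ->].
    - apply (ord_in d); auto.
    - apply shift_ord; auto using mu_in. }
  { now apply equipotent_sym, equipotent_im. }
  set (H := sep mu (fun a => g a ∈ B)).
  assert (HH : forall a, a ∈ H <-> a ∈ mu /\ g a ∈ B).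
  { intros a; unfold H; rewrite in_sep by dfn; tauto. }
  assert (HBH : B = im g H).
  { apply ext; intros X; rewrite in_im by assumption; split.
    - intros HX; pose proof (HB X HX) as HX'; apply in_im in HX' as (a & Ha & ->); [|assumption].
      exists a; rewrite HH; auto.
    - intros (a & Ha & ->); now apply HH. }
  apply (mu_not_le kappa kappa_in), (card_le_trans _ B);
    [now apply equipotent_card_le, equipotent_sym|].
  apply (card_le_trans _ H).
  { rewrite HBH; apply equipotent_card_le, equipotent_sym, equipotent_im; [assumption|].
    intros a b Ha Hb; apply HH in Ha, Hb; apply gi; tauto. }
  (* Either [I] embeds [H] into [d], or two members share an index. A shared index belongs to the
     kernel and hence to every member, so [I] is constant on [H] and [H] is bounded. *)
  destruct (classic (inj_on I H)) as [Hi|Hi].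
  - apply (card_le_trans _ d); [|now apply in_mu_le].
    apply card_le_map; exists I; split; [assumption|split; [|assumption]].
    intros a Ha; apply HH in Ha; apply Im; tauto.
  - assert (Hex : exists a b, a ∈ H /\ b ∈ H /\ a <> b /\ I a = I b).
    { apply NNPP; intros Hno; apply Hi; intros a b Ha Hb E.
      apply NNPP; intros Hab; apply Hno; exists a, b; auto. }
    destruct Hex as (a & b & Ha & Hb & Hab & E).
    apply HH in Ha as [Ha HaB], Hb as [Hb HbB].
    assert (HiD : I a ∈ D).
    { apply (HBD (g a) (g b)); auto; unfold g; rewrite !in_upr; auto. }
    apply (bounded_le _ (suc (F (I a)))); [apply mu_suc; auto|].
    intros c Hc'; apply HH in Hc' as [Hcm HcB].
    assert (Hic : I a ∈ g c).
    { destruct (classic (c = a)) as [->|Hca]; [apply in_upr; auto|].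
      apply (HBD (g c) (g a)); auto. }
    apply in_upr in Hic as [Hic|Hic].
    + rewrite Hic; apply in_suc_sub; auto using mu_in.
    + exfalso; apply (Hsd c); [now apply mu_in|]; rewrite <- Hic; auto.
Qed.

(** * The partition relation and uncountable cofinality *)

Lemma partition_uncountable_cf :
  partition_arrow_omega_plus_one mu mu -> uncountable_cf mu.
Proof.
  intros (w & w1 & Hw & Hw1 & HP); apply omega_om in Hw; apply succ_suc in Hw1; subst w w1.
  assert (Dcof : DPred (fun c => has_cofinal_map c mu)) by (unfold has_cofinal_map; dfn).
  destruct (lst_spec _ mu Dcof mu_ord mu_cofinal) as (Hco & Hcc & _ & Hmin).
  set (c := lst (fun c => has_cofinal_map c mu)) in *.
  exists om, c; split; [apply om_omega|split].
  { split; [assumption|split; [assumption|]]; intros x Hx Hxc.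
    apply ord_notin; auto; intros H; now apply (Hmin x). }
  apply NNPP; intros Hnc; apply ord_notin in Hnc; auto using ord_om.
  destruct (cofinal_index c Hco Hcc) as (F & I & DF & DI & Fm & Im & HFI & Imono).
  set (one := suc emp : M).
  set (P := sep (Pow mu) (fun x => exists a b, a ∈ mu /\ b ∈ mu /\ a <> b /\ x = upr a b)).
  (* Pairs with different indices receive colour 1. Stating this as a property of the set [x] avoids
     ordering its two elements. *)
  set (C := fun x => exists a b, a ∈ x /\ b ∈ x /\ I a <> I b).
  assert (DC : DPred C) by (unfold C; dfn).
  set (G := fun x => iota (fun y => C x /\ y = one \/ ~ C x /\ y = emp)).
  assert (DG : DFun G) by (unfold G; dfn).
  assert (G1 : forall x, C x -> G x = one).
  { intros x Hx; apply iota_eq; [auto|]; intros z ?; tauto. }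
  assert (G0 : forall x, ~ C x -> G x = emp).
  { intros x Hx; apply iota_eq; [auto|]; intros z ?; tauto. }
  assert (Hne : one <> emp).
  { intros E; apply (in_emp emp); rewrite <- E at 2; apply in_suc; auto. }
  assert (HC : forall a b, C (upr a b) <-> I a <> I b).
  { intros a b; split.
    - intros (x & y & Hx & Hy & Hxy) E; apply in_upr in Hx as [-> | ->], Hy as [-> | ->]; auto.
    - intros H; exists a, b; rewrite !in_upr; auto. }
  destruct (HP emp one (suc one) P (lam G P)) as [(H & HHm & HHo & HHc)|(H & HHm & HHo & HHc)].
  - now apply empty_emp.
  - now apply succ_suc.
  - now apply succ_suc.
  - intros x; unfold P; rewrite in_sep, in_Pow by dfn; split.
    + intros [_ (a & b & Ha & Hb & Hab & E)]; exists a, b; rewrite upair_upr; auto.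
    + intros (a & b & Ha & Hb & Hab & E); apply upair_upr in E; split; [|exists a, b; auto].
      intros z Hz; rewrite E in Hz; apply in_upr in Hz as [-> | ->]; assumption.
  - apply fun_lam; [assumption|]; intros x _; apply in_suc.
    destruct (classic (C x)) as [Hx|Hx]; [rewrite G1 by assumption; auto|].
    rewrite G0 by assumption; left; apply in_suc; auto.
  (* On a set of colour 0 all indices agree, so the set is bounded and has size at most [kappa]. *)
  - assert (HI : forall a b, a ∈ H -> b ∈ H -> I a = I b).
    { intros a b Ha Hb; apply NNPP; intros Hab.
      assert (Hab' : a <> b) by (intros ->; auto).
      pose proof (HHc a b (upr a b) Ha Hb Hab' (proj2 (upair_upr _ _ _) eq_refl)) as H'.
      apply app_lam in H' as [_ H']; [|assumption].
      rewrite G1 in H' by now apply HC.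
      now symmetry in H'. }
    destruct HHo as (_ & f & Hf & _).
    assert (HmH : card_le mu H) by (apply equipotent_card_le; now exists f).
    apply (mu_not_le kappa kappa_in), (card_le_trans _ H); [assumption|].
    pose proof (ap_in f mu H emp (proj1 (proj1 Hf)) (nat_in_mu emp nat_emp)) as Ha.
    set (a := ap f emp) in *.
    apply (bounded_le _ (suc (F (I a)))); [apply mu_suc; auto|].
    intros x Hx; rewrite <- (HI x a) by assumption.
    apply in_suc_sub; auto using mu_in.
  - destruct HHo as (_ & f & [[Hf _] _] & Ho).
    pose proof (ord_suc om ord_om) as Hso.
    (* Along a set of colour 1 the indices increase strictly, by monotonicity of [I]. An increasing
       [J] on [suc om] satisfies [om ⊆ J om], while all indices lie in [c ⊆ om]. *)
    set (J := fun x => I (ap f x)).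
    assert (DJ : DFun J) by (unfold J; dfn).
    assert (Hfm : forall x, x ∈ suc om -> ap f x ∈ mu).
    { intros x Hx; apply HHm; now apply (ap_in f (suc om)). }
    assert (HJ : forall x, x ∈ suc om -> J x ∈ om).
    { intros x Hx; apply Hnc, Im, Hfm, Hx. }
    assert (Hap : forall x, x ∈ suc om -> app f x (ap f x)).
    { intros x Hx; apply (fun_ap f (suc om) H); auto. }
    assert (Jinc : incr_on J (suc om)).
    { intros x y Hx Hy Hxy.
      pose proof (proj1 (Ho x y _ _ (Hap x Hx) (Hap y Hy)) Hxy) as Hlt.
      assert (Hle : J x ⊆ J y).
      { apply Imono; auto; apply ord_sub; auto using mu_in. }
      apply ord_subset in Hle as [?|E]; auto; try (now apply (ord_in om); auto using ord_om).
      exfalso; assert (Hxy' : ap f x <> ap f y).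
      { intros E'; rewrite E' in Hlt; now apply mem_irrefl in Hlt. }
      pose proof (HHc _ _ (upr (ap f x) (ap f y)) (ap_in f (suc om) H x Hf Hx)
        (ap_in f (suc om) H y Hf Hy) Hxy' (proj2 (upair_upr _ _ _) eq_refl)) as H'.
      apply app_lam in H' as [_ H']; [|assumption].
      rewrite G0 in H'; [auto|]; rewrite HC; intros H''; now apply H''. }
    assert (Hos : om ∈ suc om) by (apply in_suc; auto).
    apply (om_not_nat (J om)); [now apply in_om, HJ|].
    apply (incr_ge J (suc om)); auto.
    intros x Hx; now apply nat_ord, in_om, HJ.
Qed.
End Successor.

Theorem theorem2p2 (M : set_structure) (HZF : ZF M) (kappa kplus : M)
  (Hkappa : infinite_cardinal kappa)
  (Hkplus : successor_cardinal kappa kplus) :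
  ((is_cf kplus kplus <-> tree_bound kplus kappa) /\
   (is_cf kplus kplus <-> Regressive kplus kplus) /\
   (is_cf kplus kplus <-> delta_arrow kplus kplus)) /\
  (is_cf kplus kplus -> partition_arrow_omega_plus_one kplus kplus) /\
  (partition_arrow_omega_plus_one kplus kplus -> uncountable_cf kplus).
Proof.
  pose proof (is_cf_regular Hkplus) as Hreg.
  split; [split; [|split]; split|split].
  - intros H; exact (regular_tree_bound Hkappa Hkplus (Hreg H)).
  - exact (tree_bound_is_cf Hkappa Hkplus).
  - intros H; exact (regular_Regressive Hkappa Hkplus (Hreg H)).
  - exact (Regressive_is_cf Hkappa Hkplus).
  - intros H; exact (regular_delta Hkappa Hkplus (Hreg H)).
  - exact (delta_is_cf Hkappa Hkplus).
  - intros H; exact (regular_partition Hkappa Hkplus (Hreg H)).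
  - exact (partition_uncountable_cf Hkappa Hkplus).
Qed.
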